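(* Let $n\ge1$ and $\vec b=(b_1,\dots,b_n)\in\mathbb{R}^n$ with $\vec b\neq\vec 0$. Then the linear combination $S_{\vec b}(x)=\sum_{j=1}^n b_jh_j(x)$ of the first $n$ Dirichlet eigenfunctions has at most $n-1$ distinct zeros in $\mathrm I=(0,1)$. If $S_{\vec b}$ has exactly $n-1$ distinct zeros $c_1<\dots<c_{n-1}$ in $\mathrm I$, then there exists a nonzero constant $C$ such that $$S_{\vec b}(x)=C\,\mathfrak S_n(c_1,\dots,c_{n-1},x)\quad\text{for all }x\in \mathrm I .$$ Furthermore, in this case, each zero $c_j$ has order $1$.
   Context: Let $q$ be a real-valued $C^\infty$ function defined in a neighborhood of $[0,1]$, and $\mathrm I=(0,1)$. Consider the Dirichlet Sturm-Liouville problem $-y''+q\,y=\lambda y$ in $(0,1)$, $y(0)=y(1)=0$. Its eigenvalues are simple, $\lambda_1<\lambda_2<\cdots\to\infty$; $\{h_j\}_{j\ge1}$ is an associated orthonormal basis of $L^2(\mathrm I)$ consisting of real eigenfunctions, $h_j$ being associated with $\lambda_j$. The Slater determinant is $\mathfrak S_n(x_1,\dots,x_n)=\det\big(h_i(x_j)\big)_{1\le i,j\le n}$. *)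

(* Defs.v *)
From HB Require Import structures.
From mathcomp Require Export all_boot all_order all_algebra.
From mathcomp Require Export all_classical all_reals all_analysis.

Set Implicit Arguments.
Unset Strict Implicit.
Unset Printing Implicit Defensive.

Export Order.TTheory GRing.Theory Num.Theory.
Export numFieldNormedType.Exports.

Local Open Scope classical_set_scope.
Local Open Scope ring_scope.

(* Sequences are indexed from 0: [lam j] and [h j] stand for $\lambda_{j+1}$
   and $h_{j+1}$. Functions on the interval are total functions R -> R whose
   values outside [0, 1] are irrelevant. *)

Definition smooth_on (R : realType) (U : set R) (f : R -> R) : Prop :=
  forall (k : nat) (x : R), U x -> derivable (derive1n k f) x 1.

Definition smooth_near_unit_interval (R : realType) (q : R -> R) : Prop :=
  exists U : set R, [/\ open U, `[0, 1] `<=` U & smooth_on U q].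

(* Classical solutions of -y'' + q y = mu y in (0, 1), y(0) = y(1) = 0. *)
Definition dirichlet_solution (R : realType) (q : R -> R) (mu : R)
    (y : R -> R) : Prop :=
  [/\ {within `[0, 1], continuous y},
      forall x : R, x \in `]0, 1[ -> derivable y x 1 /\ derivable (derive1 y) x 1,
      forall x : R, x \in `]0, 1[ -> - derive1n 2 y x + q x * y x = mu * y x
    & y 0 = 0 /\ y 1 = 0].

Definition dirichlet_eigenfunction (R : realType) (q : R -> R) (mu : R)
    (y : R -> R) : Prop :=
  dirichlet_solution q mu y /\ exists2 x, x \in `]0, 1[ & y x != 0.

Definition dirichlet_eigenvalue (R : realType) (q : R -> R) (mu : R) : Prop :=
  exists y : R -> R, dirichlet_eigenfunction q mu y.

Definition simple_dirichlet_eigenvalue (R : realType) (q : R -> R) (mu : R) :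
    Prop :=
  exists2 y : R -> R, dirichlet_eigenfunction q mu y &
    forall z, dirichlet_solution q mu z ->
      exists a : R, forall x : R, x \in `[0, 1] -> z x = a * y x.

Definition dirichlet_spectrum (R : realType) (q : R -> R) (lam : nat -> R) :
    Prop :=
  [/\ forall i j : nat, (i < j)%N -> lam i < lam j,
      forall mu : R, dirichlet_eigenvalue q mu <-> exists j, mu = lam j,
      forall j, simple_dirichlet_eigenvalue q (lam j)
    & lam @ \oo --> +oo].

Definition square_integrable (R : realType) (f : R -> R) : Prop :=
  measurable_fun (`]0%R, 1%R[ : set R) f /\
  (@lebesgue_measure R).-integrable `]0%R, 1%R[ (fun x => (f x ^+ 2)%:E).

Definition L2_inner (R : realType) (f g : R -> R) : R :=
  \int[@lebesgue_measure R]_(x in `]0, 1[) (f x * g x).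

Definition L2_orthonormal_basis (R : realType) (h : nat -> R -> R) : Prop :=
  [/\ forall j, square_integrable (h j),
      forall i j, L2_inner (h i) (h j) = (i == j)%:R
    & forall f, square_integrable f ->
        (fun N : nat => \int[@lebesgue_measure R]_(x in `]0%R, 1%R[)
          ((f x - \sum_(j < N) L2_inner f (h j) * h j x) ^+ 2)%:E)%E
        @ \oo --> (0 : \bar R)%E].

Definition slater (R : realType) (h : nat -> R -> R) (n : nat)
    (x : 'I_n -> R) : R :=
  \det (\matrix_(i < n, j < n) h i (x j)).

Definition lin_comb (R : realType) (h : nat -> R -> R) (n : nat)
    (b : 'rV[R]_n) (x : R) : R :=
  \sum_(j < n) b 0 j * h j x.

Definition zeros_in_unit_interval (R : realType) (f : R -> R) : set R :=
  [set x | (x \in `]0, 1[) /\ f x = 0].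

Definition zero_of_order (R : realType) (f : R -> R) (x : R) (k : nat) : Prop :=
  (forall i : nat, (i < k)%N -> derive1n i f x = 0) /\ derive1n k f x != 0.

(* Main.v *)
(* Idea, after Liouville. Let S = sum_(j < n) b_j h_j and let T be the operator
   multiplying b_j by lam_j - lam_0. The Wronskian W = h_0 S' - h_0' S vanishes
   at 0 and 1, (S / h_0)' = W / h_0^2 and W' = - h_0 (T S), so two applications
   of Rolle's theorem show that T S has at least as many distinct zeros in (0, 1)
   as S, and one more if S has a double zero. Normalized iterates T^k S converge
   in C^1 to the eigenfunction h_m of the highest mode of S, whose zeros are
   simple, so S has no more zeros than h_m. Finally h_m has at most m zeros, by
   Courant's variational argument: with more zeros, some product of h_m by a
   step function jumping at the zeros would be orthogonal to h_0, ..., h_(m-1)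
   and have Rayleigh quotient lam_m, hence be a multiple of h_m. *)
Require Import Defs.
From mathcomp Require Import measurable_realfun ring lra.

Local Open Scope classical_set_scope.
Local Open Scope ring_scope.

(** * Real functions of one variable *)

Section RealFunctions.
Set Implicit Arguments.
Unset Strict Implicit.
Unset Printing Implicit Defensive.
Variable R : realType.
Implicit Types (f df g F : R -> R) (a b c d x y : R) (s zs : seq R).

(** The Slater formula is linear algebra once the zero bound is known: evaluation at any $n$
    distinct points of $(0,1)$ is then injective on the span, so vanishing at $n-1$ of them leaves
    one direction, that of the cofactors of the last column. At a double zero, $TS$ would have $n$
    zeros; hence $TS=0$ and $S$ is a multiple of $h_0$, which has no zero. The end points shape the
    analysis. Eigenfunctions are only assumed continuous there, $h_0$ vanishes there, and
    derivatives have arbitrary values there. So $S/h_0$ is used only between interior zeros, and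
    products with derivatives are continuous at 0 and 1 as a vanishing factor times a bounded one.
    Likewise $h_m$ times a step function has corners at the jumps. Its Rayleigh quotient is replaced
    by an inequality on partial sums of its expansion, whose error is the $L^2$ remainder and tends
    to 0 by completeness. *)

Lemma is_derive_add f g x (a b : R) : is_derive x 1 f a -> is_derive x 1 g b ->
  is_derive x 1 (fun t => f t + g t) (a + b).
Proof. by move=> fa gb; exact: (is_deriveD fa gb). Qed.

Lemma is_derive_mul f g x (a b : R) : is_derive x 1 f a -> is_derive x 1 g b ->
  is_derive x 1 (fun t => f t * g t) (a * g x + f x * b).
Proof.
move=> fa gb; have := is_deriveM fa gb.
by rewrite /GRing.scale/= addrC (mulrC (g x)).
Qed.

Lemma is_derive_scale f x (k a : R) : is_derive x 1 f a ->
  is_derive x 1 (fun t => k * f t) (k * a).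
Proof. by move=> fa; exact: (is_deriveZ k fa). Qed.

Lemma is_derive_expR_scale (k x : R) :
  is_derive x 1 (fun t => expR (k * t)) (k * expR (k * x)).
Proof.
have kd : is_derive x 1 (fun t => k * t) k.
  by have := @is_derive_scale id x k 1 (is_derive_id _ _); rewrite mulr1.
have := @is_derive1_comp _ expR (fun t => k * t) x _ _ (is_derive_expR _) kd.
by rewrite mulrC.
Qed.

Lemma continuous_within_subitv f a b c d :
  a <= c -> d <= b -> {within `[a, b], continuous f} ->
  {within `[c, d], continuous f}.
Proof.
move=> ac db; apply: continuous_subspaceW => x /=.
by rewrite !in_itv/= => /andP[cx xd]; rewrite (le_trans ac cx) (le_trans xd db).
Qed.

Lemma lipschitz_of_bounded_derivative f df a b M :
  {within `[a, b], continuous f} ->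
  {in `]a, b[, forall x, is_derive x 1 f (df x)} ->
  {in `]a, b[, forall x, `|df x| <= M} ->
  {in `[a, b] &, forall x y, `|f y - f x| <= M * `|y - x|}.
Proof.
move=> fc fd fM x y; wlog xy : x y / x <= y.
  move=> H xab yab; have /orP[|] := le_total x y; first by move=> /H; apply.
  by move=> /H; rewrite (distrC (f y)) (distrC y); apply.
rewrite !in_itv/= => /andP[ax xb] /andP[ay yb].
move: xy; rewrite le_eqVlt => /predU1P[->|xy]; first by rewrite !subrr normr0 mulr0.
have sub z : z \in `]x, y[ -> z \in `]a, b[.
  by rewrite !in_itv/= => /andP[xz zy]; rewrite (le_lt_trans ax xz) (lt_le_trans zy yb).
have [z zxy ->] := @MVT R f df x y xy (fun z zxy => fd z (sub z zxy))
  (continuous_within_subitv ax yb fc).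
by rewrite normrM ler_wpM2r// fM// sub.
Qed.

(** Cutting the interval at the exceptional points reduces to the mean value theorem on each piece;
    continuity glues the pieces. The exceptional points will be the jumps of a step function. *)
Lemma nondecreasing_except f df a b zs :
  a <= b -> {within `[a, b], continuous f} ->
  (forall x, x \in `]a, b[ -> x \notin zs -> is_derive x 1 f (df x)) ->
  (forall x, x \in `]a, b[ -> x \notin zs -> 0 <= df x) -> f a <= f b.
Proof.
elim: zs a b => [|z zs IH] a b ab fc fd df0.
  move: ab; rewrite le_eqVlt => /predU1P[->//|ab].
  have [c cab] := @MVT R f df a b ab (fun z zab => fd z zab isT) fc.
  by move=> E; rewrite -subr_ge0 E mulr_ge0 ?df0// subr_ge0 ltW.
have split (u v : R) : a <= u -> u <= v -> v <= b -> z \notin `]u, v[ -> f u <= f v.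
  move=> au uv vb zuv.
  have fc' : {within `[u, v], continuous f}.
    exact: (@continuous_within_subitv f a b u v au vb fc).
  have sub x : x \in `]u, v[ -> x \notin zs -> (x \in `]a, b[) /\ (x \notin z :: zs).
    move=> xuv xzs; split.
      by move: xuv; rewrite !in_itv/= => /andP[/(le_lt_trans au)-> /lt_le_trans->].
    by rewrite inE negb_or xzs andbT; apply: contraNneq zuv => <-.
  have fd' x : x \in `]u, v[ -> x \notin zs -> is_derive x 1 f (df x).
    by move=> xuv xzs; have [? ?] := sub x xuv xzs; exact: fd.
  have df0' x : x \in `]u, v[ -> x \notin zs -> 0 <= df x.
    by move=> xuv xzs; have [? ?] := sub x xuv xzs; exact: df0.
  exact: IH uv fc' fd' df0'.
have [zab|zab] := boolP (z \in `]a, b[); last exact: split.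
move: zab; rewrite in_itv/= => /andP[az zb].
apply: (@le_trans _ _ (f z)); apply: split => //; rewrite ?ltW// in_itv/= ltxx ?andbF//.
Qed.

(** The points found avoid the given zeros because they lie strictly between consecutive ones. This
    disjointness lets double zeros be added later without repetition. *)
Lemma rolle_seq f df a b x s :
  a <= x -> last x s <= b -> path <%R x s ->
  {within `[a, b], continuous f} ->
  {in `]a, b[, forall y, is_derive y 1 f (df y)} ->
  {in x :: s, forall y, f y = 0} ->
  exists t, [/\ size t = size s, path <%R x t,
    forall y, y \in t -> [/\ y \in `]x, last x s[, y \notin x :: s & df y = 0]
    & last x t <= last x s].
Proof.
elim: s a x => [|y s IH] a x ax lb /= => [_ _ _ _|/andP[xy ys] fc fd f0].
  by exists [::].
have f0' : {in y :: s, forall y, f y = 0} by move=> z zs; rewrite f0// inE zs orbT.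
have ylast : y <= last y s.
  move: ys; rewrite lt_path_sortedE => /andP[/allP ys _].
  by case: s {IH lb f0 f0'} ys => // z s /(_ _ (mem_last z s)) /ltW.
have [t [st pt tP lt]] := IH a y (le_trans ax (ltW xy)) lb ys fc fd f0'.
have yb : y <= b := le_trans ylast lb.
have [c cxy cd] : exists2 c, c \in `]x, y[ & is_derive c 1 f 0.
  apply: Rolle => //; last by rewrite !f0// !inE eqxx ?orbT.
    move=> z; rewrite in_itv/= => /andP[xz zy].
    by have [] := fd z; rewrite // in_itv/= (le_lt_trans ax xz) (lt_le_trans zy yb).
  exact: (continuous_within_subitv ax yb fc).
move: (cxy); rewrite in_itv/= => /andP[xc cy].
exists (c :: t); split => /=; first by rewrite st.
- rewrite xc/=; case: t pt {st tP lt} => //= z t /andP[yz ->].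
  by rewrite (lt_trans cy yz).
- move=> z; rewrite inE => /predU1P[->|/tP[zys zyn ->]]; last first.
    split => //.
      by move: zys; rewrite !in_itv/= => /andP[yz ->]; rewrite (lt_trans xy yz).
    rewrite inE negb_or zyn andbT gt_eqF//.
    by move: zys; rewrite in_itv/= => /andP[yz _]; rewrite (lt_trans xy yz).
  split.
  + by rewrite in_itv/= xc (lt_le_trans cy ylast).
  + rewrite inE negb_or gt_eqF//=; apply/negP.
    move: ys; rewrite lt_path_sortedE => /andP[/allP ys _].
    rewrite inE => /predU1P[E|/ys cs]; first by rewrite E ltxx in cy.
    by have := lt_trans cs cy; rewrite ltxx.
  + have dc : is_derive c 1 f (df c).
      by apply: fd; rewrite in_itv/= (le_lt_trans ax xc) (lt_le_trans cy yb).
    by rewrite -(@derive_val _ _ _ _ _ _ _ dc) (@derive_val _ _ _ _ _ _ _ cd).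
- case: t pt lt {st tP} => //= _ _; exact: ltW (lt_le_trans cy ylast).
Qed.

(* e(x) exp(K x) is nondecreasing and e(x) exp(- K x) is nonincreasing. *)
Lemma gronwall_lower (e de : R -> R) K a b :
  {in `]a, b[, forall x, is_derive x 1 e (de x)} ->
  {in `]a, b[, forall x, `|de x| <= K * e x} ->
  {in `]a, b[ &, forall x y, e x * expR (- (K * `|y - x|)) <= e y}.
Proof.
move=> ed eK.
have main (sg k : R) x y : x <= y -> x \in `]a, b[ -> y \in `]a, b[ ->
  (forall z, z \in `]a, b[ -> 0 <= sg * (de z + k * e z)) ->
  sg * (e x * expR (k * x)) <= sg * (e y * expR (k * y)).
  move=> xy; rewrite !in_itv/= => /andP[ax xb] /andP[ay yb] H.
  have sub z : z \in `[x, y] -> z \in `]a, b[.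
    by rewrite !in_itv/= => /andP[xz zy]; rewrite (lt_le_trans ax xz) (le_lt_trans zy yb).
  pose dg z := sg * ((de z + k * e z) * expR (k * z)).
  have gd z : z \in `]a, b[ -> is_derive z 1 (fun t => sg * (e t * expR (k * t))) (dg z).
    move=> zab; have ez := ed _ zab.
    have := is_derive_scale sg (is_derive_mul ez (is_derive_expR_scale k z)).
    by congr is_derive; rewrite /dg; ring.
  apply: (@nondecreasing_except (fun t => sg * (e t * expR (k * t))) dg _ _ [::]) => //.
  - apply: derivable_within_continuous => z zxy.
    by have [] := gd z (sub _ zxy).
  - by move=> z zxy _; apply: gd; apply: sub; apply: subset_itv_oo_cc.
  - move=> z zxy _; rewrite /dg mulrA mulr_ge0 ?expR_ge0// H// sub//.
    exact: subset_itv_oo_cc.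
move=> x y xab yab; have [xy|/ltW yx] := leP x y.
- have := main 1 K x y xy xab yab; rewrite !mul1r.
  rewrite ger0_norm ?subr_ge0// mulrBr opprB expRD expRN mulrA ler_pdivrMr ?expR_gt0//.
  by apply => z zab; rewrite mul1r; have := eK z zab; rewrite ler_norml => /andP[+ _]; lra.
- have H : -1 * (e y * expR (- K * y)) <= -1 * (e x * expR (- K * x)).
    apply: main => // z zab.
    by rewrite mulN1r; have := eK z zab; rewrite ler_norml => /andP[_ +]; lra.
  have -> : - (K * `|y - x|) = K * y - K * x by rewrite ler0_norm ?subr_le0//; ring.
  rewrite expRD expRN mulrA ler_pdivrMr ?expR_gt0//.
  move: H; rewrite !mulN1r lerN2 !mulNr !expRN ler_pdivrMr ?expR_gt0//.
  by rewrite mulrAC ler_pdivlMr ?expR_gt0.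
Qed.
End RealFunctions.

(** * Regularity of Dirichlet eigenfunctions *)

Section DirichletFunctions.
Set Implicit Arguments.
Unset Strict Implicit.
Unset Printing Implicit Defensive.
Variable R : realType.
Implicit Types (f g df dg ddf ddg q y : R -> R) (a b c x mu : R) (s zs : seq R).

Lemma bounded_on_segment f a b : a <= b -> {within `[a, b], continuous f} ->
  exists2 M : R, 0 <= M & {in `[a, b], forall x, `|f x| <= M}.
Proof.
move=> ab fc.
have [u _ fu] := EVT_max ab fc; have [v _ fv] := EVT_min ab fc.
exists (`|f u| + `|f v|) => [|x xab]; first by rewrite addr_ge0.
have := fu x xab; have := fv x xab.
have := ler_norm (f u); have := ler_norm (- f v); rewrite normrN ler_norml.
have := normr_ge0 (f u); have := normr_ge0 (f v).
by move=> *; apply/andP; split; lra.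
Qed.

(* Only the continuity of [f] is imposed at the end points: the values of [df]
   and [ddf] there are junk. *)
Definition dirichlet_C2 f df ddf : Prop :=
  [/\ {within `[0, 1], continuous f},
      {in `]0, 1[, forall x, is_derive x 1 f (df x)},
      {in `]0, 1[, forall x, is_derive x 1 df (ddf x)},
      exists2 M : R, 0 <= M & {in `]0, 1[, forall x, `|df x| <= M}
    & f 0 = 0 /\ f 1 = 0].

Lemma smooth_near_unit_continuous q : smooth_near_unit_interval q ->
  {within `[0, 1], continuous q} /\ {in `]0, 1[, forall x, {for x, continuous q}}.
Proof.
move=> [U [_ IU qU]].
have dq x : x \in `[0, 1] -> derivable q x 1 by move=> /IU; exact: (qU 0%N).
split; first exact: derivable_within_continuous.
move=> x /subset_itv_oo_cc/dq dqx.
by apply: differentiable_continuous; apply/derivable1_diffP.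
Qed.

(** A solution carries no information on y' near 0 and 1. The bound on y' comes from the equation:
    y'' = (q - mu) y is bounded, so y' stays within [K] of its value at the midpoint. *)
Lemma dirichlet_solution_C2 q mu y : {within `[0, 1], continuous q} ->
  dirichlet_solution q mu y ->
  dirichlet_C2 y (derive1 y) (fun x => (q x - mu) * y x).
Proof.
move=> qc [yc yd yE [y0 y1]].
have ddy x : x \in `]0, 1[ -> is_derive x 1 (derive1 y) ((q x - mu) * y x).
  move=> x01; have [_ dd] := yd x x01; apply: DeriveDef => //.
  have := yE x x01; rewrite derive1nS derive1n1 !derive1E; lra.
split => //.
  by move=> x x01; have [d _] := yd x x01; apply: DeriveDef; rewrite // derive1E.
have [Mq Mq0 qM] := bounded_on_segment ler01 qc.
have [My My0 yM] := bounded_on_segment ler01 yc.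
pose m : R := 2^-1; have m01 : m \in `]0, 1[ by rewrite in_itv/= /m; lra.
pose K := (Mq + `|mu|) * My.
have K0 : 0 <= K by rewrite mulr_ge0// addr_ge0.
exists (`|derive1 y m| + K) => [|x x01]; first by rewrite addr_ge0.
suff : `|derive1 y x - derive1 y m| <= K.
  by rewrite -lerBlDl; apply: le_trans; exact: lerB_dist.
have sub (u v z : R) : u \in `]0, 1[ -> v \in `]0, 1[ -> z \in `[u, v] -> z \in `]0, 1[.
  rewrite !in_itv/= => /andP[u0 _] /andP[_ v1] /andP[uz zv].
  by rewrite (lt_le_trans u0 uz) (le_lt_trans zv v1).
have main (u v : R) : u <= v -> u \in `]0, 1[ -> v \in `]0, 1[ ->
    `|derive1 y v - derive1 y u| <= K.
  move=> uv u01 v01.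
  have : `|derive1 y v - derive1 y u| <= K * `|v - u|.
    apply: (@lipschitz_of_bounded_derivative _ _ (fun x => (q x - mu) * y x) u v).
    - by apply: derivable_within_continuous => z zuv; have [] := ddy z (sub _ _ _ u01 v01 zuv).
    - by move=> z /subset_itv_oo_cc zuv; apply: ddy; exact: sub zuv.
    - move=> z /subset_itv_oo_cc zuv; have z01 := subset_itv_oo_cc (sub _ _ _ u01 v01 zuv).
      by rewrite normrM ler_pM// ?yM// (le_trans (ler_normB _ _))// lerD2r qM.
    - by rewrite in_itv/= lexx.
    - by rewrite in_itv/= lexx uv.
  move/le_trans; apply; rewrite ger0_norm ?subr_ge0// ler_piMr//.
  by move: u01 v01; rewrite !in_itv/=; lra.
have [xm|/ltW mx] := leP x m; last exact: main.
by rewrite distrC; exact: main.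
Qed.

Lemma dirichlet_C2_scale f df ddf a : dirichlet_C2 f df ddf ->
  dirichlet_C2 (fun x => a * f x) (fun x => a * df x) (fun x => a * ddf x).
Proof.
move=> [fc fd fdd [M M0 fM] [f0 f1]]; split.
- by move=> x; apply: cvgM; [exact: cvg_cst|exact: fc].
- by move=> x x01; apply: is_derive_scale; exact: fd.
- by move=> x x01; apply: is_derive_scale; exact: fdd.
- exists (`|a| * M) => [|x x01]; first exact: mulr_ge0.
  by rewrite normrM ler_wpM2l// fM.
- by rewrite f0 f1 !mulr0.
Qed.

Lemma dirichlet_C2_add f df ddf g dg ddg :
  dirichlet_C2 f df ddf -> dirichlet_C2 g dg ddg ->
  dirichlet_C2 (fun x => f x + g x) (fun x => df x + dg x) (fun x => ddf x + ddg x).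
Proof.
move=> [fc fd fdd [M M0 fM] [f0 f1]] [gc gd gdd [N N0 gN] [g0 g1]]; split.
- by move=> x; apply: cvgD; [exact: fc|exact: gc].
- by move=> x x01; apply: is_derive_add; [exact: fd|exact: gd].
- by move=> x x01; apply: is_derive_add; [exact: fdd|exact: gdd].
- exists (M + N) => [|x x01]; first exact: addr_ge0.
  by rewrite (le_trans (ler_normD _ _))// lerD ?fM ?gN.
- by rewrite f0 f1 g0 g1 addr0.
Qed.

Lemma dirichlet_C2_zero : dirichlet_C2 (fun=> 0) (fun=> 0) (fun=> 0).
Proof.
split => //.
- by move=> x; exact: cvg_cst.
- by move=> x _; exact: is_derive_cst.
- by move=> x _; exact: is_derive_cst.
- by exists 0 => // x _; rewrite normr0.
Qed.

Lemma dirichlet_C2_sum (I : Type) (r : seq I) (P : pred I) (a : I -> R)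
    (f df ddf : I -> R -> R) :
  (forall i, dirichlet_C2 (f i) (df i) (ddf i)) ->
  dirichlet_C2 (fun x => \sum_(i <- r | P i) a i * f i x)
    (fun x => \sum_(i <- r | P i) a i * df i x)
    (fun x => \sum_(i <- r | P i) a i * ddf i x).
Proof.
move=> H; elim: r => [|i r IH].
  have := dirichlet_C2_zero; congr dirichlet_C2;
    by apply/funext => x; rewrite big_nil.
have [Pi|nPi] := boolP (P i); last first.
  by move: IH; congr dirichlet_C2; apply/funext => x; rewrite big_cons (negbTE nPi).
by have := dirichlet_C2_add (dirichlet_C2_scale (a i) (H i)) IH;
  congr dirichlet_C2; apply/funext => x; rewrite big_cons Pi.
Qed.

Lemma dirichlet_C2_bounded f df ddf : dirichlet_C2 f df ddf ->
  exists2 M : R, 0 <= M &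
    {in `[0, 1], forall x, `|f x| <= M} /\ {in `]0, 1[, forall x, `|df x| <= M}.
Proof.
move=> [fc _ _ [M M0 fM] _]; have [N N0 fN] := bounded_on_segment ler01 fc.
exists (M + N); first exact: addr_ge0.
by split => x x01; [rewrite (le_trans (fN x x01))// lerDr|rewrite (le_trans (fM x x01))// lerDl].
Qed.

(** A quantitative form of uniqueness for the Cauchy problem: E = y^2 + y'^2 satisfies |E'| <= K E,
    because 2 |y y'| <= E, so positivity at one point spreads to all of (0, 1), uniformly up to the
    ends. In particular zeros of y are simple. *)
Lemma eigenfunction_energy_lower q mu y : {within `[0, 1], continuous q} ->
  dirichlet_eigenfunction q mu y ->
  exists2 e : R, 0 < e & {in `]0, 1[, forall x, e <= y x ^+ 2 + derive1 y x ^+ 2}.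
Proof.
move=> qc [ysol [x0 x001 yx0]].
have [yc yd ydd _ _] := dirichlet_solution_C2 qc ysol.
pose e x := y x ^+ 2 + derive1 y x ^+ 2.
pose de x := 2 * y x * derive1 y x + 2 * derive1 y x * ((q x - mu) * y x).
have [Mq Mq0 qM] := bounded_on_segment ler01 qc.
pose K := 1 + Mq + `|mu|.
have ed : {in `]0, 1[, forall x, is_derive x 1 e (de x)}.
  move=> x x01; have dy := yd x x01; have ddy := ydd x x01.
  have := is_derive_add (is_derive_mul dy dy) (is_derive_mul ddy ddy).
  by congr is_derive; rewrite /de; ring.
have eK : {in `]0, 1[, forall x, `|de x| <= K * e x}.
  move=> x x01; rewrite /de /e.
  have qmu : `|q x - mu| <= Mq + `|mu|.
    by rewrite (le_trans (ler_normB _ _))// lerD2r qM// subset_itv_oo_cc.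
  have -> : 2 * y x * derive1 y x + 2 * derive1 y x * ((q x - mu) * y x) =
    (1 + (q x - mu)) * (2 * y x * derive1 y x) by ring.
  rewrite normrM ler_pM//.
    by rewrite (le_trans (ler_normD _ _))// normr1 /K -addrA lerD2l.
  rewrite ler_norml.
  have := sqr_ge0 (y x + derive1 y x); have := sqr_ge0 (y x - derive1 y x).
  by move=> *; apply/andP; split; lra.
have K0 : 0 <= K by rewrite !addr_ge0.
have e0 : 0 < e x0.
  by rewrite ltr_wpDr ?sqr_ge0// exprn_even_gt0.
exists (e x0 * expR (- K)); first by rewrite mulr_gt0 ?expR_gt0.
move=> x x01; apply: le_trans (gronwall_lower ed eK x001 x01).
apply: (ler_wpM2l (ltW e0)); rewrite ler_expR lerN2 ler_piMr// ler_norml.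
by move: x01 x001; rewrite !in_itv/=; lra.
Qed.

(** On an interval where y vanishes identically y' vanishes too, against the lower bound on the
    energy. *)
Lemma eigenfunction_neq0_dense q mu y a b : {within `[0, 1], continuous q} ->
  dirichlet_eigenfunction q mu y -> 0 <= a -> a < b -> b <= 1 ->
  exists2 x, x \in `]a, b[ & y x != 0.
Proof.
move=> qc yeig a0 ab b1; apply: contrapT => H.
have [e e0 ye] := eigenfunction_energy_lower qc yeig.
have [_ yd _ _ _] := dirichlet_solution_C2 qc yeig.1.
have y0 x : x \in `]a, b[ -> y x = 0.
  by move=> xab; apply: contrapT => /eqP yx; apply: H; exists x.
have sub x : x \in `]a, b[ -> x \in `]0, 1[.
  by rewrite !in_itv/= => /andP[/(le_lt_trans a0)-> /lt_le_trans->].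
pose m := (a + b) / 2.
have mab : m \in `]a, b[ by rewrite in_itv/= /m; lra.
have : derive1 y m = 0.
  rewrite derive1E -(@derive_val _ _ _ _ _ _ _ (is_derive_cst 0 m 1)).
  apply: near_eq_derive.
  near=> z; rewrite /cst y0//.
  near: z; exact: near_in_itvoo.
have := ye m (sub _ mab); rewrite y0// => /[swap] ->.
by rewrite expr0n/= addr0 leNgt e0.
Unshelve. all: by end_near.
Qed.

End DirichletFunctions.

(** * Zeros: Liouville's step and stability *)

Section Zeros.
Set Implicit Arguments.
Unset Strict Implicit.
Unset Printing Implicit Defensive.
Variable R : realType.
Implicit Types (f g df dg ddf ddg : R -> R) (a b x y z M : R) (s c d t : seq R).

Lemma cvg_mul_bounded0 (F : set_system R) {FF : Filter F} f g M :
  f @ F --> 0 -> (\forall x \near F, `|g x| <= M) ->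
  (fun x => f x * g x) @ F --> 0.
Proof.
move=> f0 gM; apply/cvgr0Pnorm_lt => e e0.
have M1 : 0 < `|M| + 1 by rewrite ltr_wpDl.
have := (cvgr0Pnorm_lt _).1 f0 (e / (`|M| + 1)) (divr_gt0 e0 M1).
move=> fe; near=> x.
have fx : `|f x| < e / (`|M| + 1) by near: x; exact: fe.
have gx : `|g x| <= M by near: x; exact: gM.
rewrite normrM (@le_lt_trans _ _ (`|f x| * (`|M| + 1)))//.
  rewrite ler_wpM2l// (le_trans gx)// (le_trans (ler_norm _))//.
  by rewrite lerDl.
by rewrite -ltr_pdivlMr.
Unshelve. all: by end_near. Qed.

(** Wherever [g] may be discontinuous, at the end points or at a jump, [f] tends to 0 and [g] is
    bounded, so the product tends to 0. *)
Lemma continuous_mul_vanishing f g M :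
  {within `[0, 1], continuous f} -> f 0 = 0 -> f 1 = 0 ->
  {in `]0, 1[, forall x, f x = 0 \/ {for x, continuous g}} ->
  {in `]0, 1[, forall x, `|g x| <= M} ->
  {within `[0, 1], continuous (fun x => f x * g x)}.
Proof.
move=> fc f0 f1 gc gM.
have [fi fl fr] := (continuous_within_itvP f ltr01).1 fc.
apply/(continuous_within_itvP _ ltr01); split.
- move=> x x01; have [fx0|gx] := gc x x01; last by apply: cvgM; [exact: fi|].
  rewrite /continuous_at fx0 mul0r; apply: (@cvg_mul_bounded0 _ _ f g M).
    by rewrite -[X in _ --> X]fx0; exact: fi.
  by near=> y; apply: gM; near: y; exact: near_in_itvoo.
- rewrite f0 mul0r; apply: (@cvg_mul_bounded0 _ _ f g M).
    by rewrite -[X in _ --> X]f0.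
  near=> x; apply: gM; rewrite in_itv/=; apply/andP; split.
    by near: x; exact: nbhs_right_gt.
  by near: x; exact: nbhs_right_lt.
- rewrite f1 mul0r; apply: (@cvg_mul_bounded0 _ _ f g M).
    by rewrite -[X in _ --> X]f1.
  near=> x; apply: gM; rewrite in_itv/=; apply/andP; split.
    by near: x; exact: nbhs_left_gt.
  by near: x; exact: nbhs_left_lt.
Unshelve. all: by end_near. Qed.

Lemma is_derive_continuous f a x : is_derive x 1 f a -> {for x, continuous f}.
Proof.
move=> fa; apply: differentiable_continuous; apply/derivable1_diffP.
exact: (@ex_derive _ _ _ _ _ _ _ fa).
Qed.

Definition zeros_in f s : Prop := {in s, forall x, (x \in `]0, 1[) /\ f x = 0}.

(* Rolle's theorem is applied to [g / f], whose derivative is [W / f^2] with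
   [W = f g' - f' g], and then to [W], which also vanishes at 0 and 1. *)
Lemma liouville_step f df ddf g dg ddg c d :
  dirichlet_C2 f df ddf -> dirichlet_C2 g dg ddg ->
  {in `]0, 1[, forall x, f x != 0} ->
  uniq c -> zeros_in g c ->
  uniq d -> {subset d <= c} -> {in d, forall x, dg x = 0} ->
  exists t, [/\ uniq t, size t = (size c + size d)%N &
    zeros_in (fun x => f x * ddg x - ddf x * g x) t].
Proof.
move=> [fc fd fdd [Mf Mf0 fM] [f0 f1]] [gc gd gdd [Mg Mg0 gM] [g0 g1]] fn0.
move=> uc c0 ud dc d0.
pose W x := f x * dg x - df x * g x.
pose dW x := f x * ddg x - ddf x * g x.
have Wd x : x \in `]0, 1[ -> is_derive x 1 W (dW x).
  move=> x01.
  have := is_derive_add (is_derive_mul (fd x x01) (gdd x x01))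
    (is_derive_scale (-1) (is_derive_mul (fdd x x01) (gd x x01))).
  have -> : (fun v => f v * dg v + -1 * (df v * g v)) = W.
    by apply/funext => v; rewrite mulN1r.
  by congr is_derive; rewrite /dW; ring.
have Wc : {within `[0, 1], continuous W}.
  have -> : W = (fun x => f x * dg x) \- (fun x => g x * df x).
    by apply/funext => x; rewrite /W /= (mulrC (df x)).
  move=> x; apply: cvgB.
    apply: (continuous_mul_vanishing fc f0 f1 _ gM) => z z01.
    right; exact: is_derive_continuous (gdd z z01).
  apply: (continuous_mul_vanishing gc g0 g1 _ fM) => z z01.
  right; exact: is_derive_continuous (fdd z z01).
have W0 : W 0 = 0 by rewrite /W f0 g0 mul0r mulr0 subr0.
have W1 : W 1 = 0 by rewrite /W f1 g1 mul0r mulr0 subr0.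
(* For nonempty [c], Rolle gives [size c - 1] zeros of W, and [d] adds [size d]; the [maxn 1] covers
   empty [c]. The end points 0 and 1 will bring the count of zeros of W' back to
   [size c + size d]. *)
have [u [uu su uW]] : exists u, [/\ uniq u, (size u).+1 = maxn 1 (size c + size d)
    & zeros_in W u].
  have : sorted <%R (sort <=%R c) by rewrite sort_lt_sorted.
  have : size (sort <=%R c) = size c by rewrite size_sort.
  have : sort <=%R c =i c by move=> z; rewrite mem_sort.
  case: (sort <=%R c) => [|x s] sc; last first.
    move=> ss ps.
    have xs01 z : z \in x :: s -> z \in `]0, 1[ by rewrite sc => /c0[].
    have lx : x <= last x s.
      move: ps; rewrite /= lt_path_sortedE => /andP[/allP xs _].
      by case: s xs {ss xs01 sc} => // z s /(_ _ (mem_last z s)) /ltW.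
    have xl z : z \in `[x, last x s] -> z \in `]0, 1[.
      have := xs01 _ (mem_head x s); have := xs01 _ (mem_last x s).
      rewrite !in_itv/= => /andP[_ l1] /andP[x0 _] /andP[xz zl].
      by rewrite (lt_le_trans x0 xz) (le_lt_trans zl l1).
    have qd z : z \in `[x, last x s] ->
        is_derive z 1 (fun v => g v * (f v)^-1) (W z / f z ^+ 2).
      move=> /xl z01; have fz := fn0 z z01.
      have := is_derive_mul (gd z z01) (is_deriveV fz (fd z z01)).
      by congr is_derive; rewrite /W /GRing.scale/=; field.
    have [] := @rolle_seq _ (fun v => g v * (f v)^-1) (fun z => W z / f z ^+ 2)
      x (last x s) x s (lexx _) (lexx _) ps.
    - apply: derivable_within_continuous => z zxl.
      exact: (@ex_derive _ _ _ _ _ _ _ (qd z zxl)).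
    - by move=> z /subset_itv_oo_cc/qd.
    - by move=> z; rewrite sc => /c0[_ ->]; rewrite mul0r.
    move=> u [su pu uP _].
    (* The Rolle points avoid [c], hence [d]; at a point of [d] both [g] and [dg] vanish, so W
       does. *)
    exists (u ++ d); split.
    - rewrite cat_uniq ud andbT (lt_sorted_uniq (path_sorted pu))/=.
      apply/hasPn => z /dc zc; apply/negP => /uP[_ + _].
      by rewrite sc zc.
    - by rewrite size_cat su -ss/= addSn maxnE subn1/= add1n.
    - move=> z; rewrite mem_cat => /orP[/uP[zxl _ Wz]|zd].
        have z01 := xl z (subset_itv_oo_cc zxl).
        split => //; move/eqP: Wz; rewrite mulf_eq0 invr_eq0 expf_eq0/=.
        by rewrite (negbTE (fn0 _ z01)) orbF => /eqP.
      have [z01 gz] := c0 z (dc z zd).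
      by split => //; rewrite /W gz d0// !mulr0 subr0.
  move=> /esym/size0nil c_nil _.
  have d_nil : d = [::].
    by case: d dc {ud d0} => // z d' /(_ z (mem_head _ _)); rewrite c_nil.
  by exists [::]; rewrite c_nil d_nil.
have [sz|sz] := posnP (size c + size d); first by exists [::].
have pu : path <%R 0 (rcons (sort <=%R u) 1).
  rewrite lt_path_pairwise /= pairwise_rcons -lt_sorted_pairwise sort_lt_sorted uu.
  rewrite andbT all_rcons ltr01/=; apply/andP; split; apply/allP => z;
    by rewrite mem_sort => /uW[]; rewrite in_itv/= => /andP[].
have [||t [st pt tP _]] := @rolle_seq _ W dW 0 1 0 _ (lexx _) _ pu Wc Wd.
- by rewrite last_rcons.
- move=> z; rewrite inE => /predU1P[->//|].
  by rewrite mem_rcons inE mem_sort => /predU1P[->//|/uW[]].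
exists t; split.
- exact: lt_sorted_uniq (path_sorted pt).
- rewrite st size_rcons size_sort su.
  by case: (size c + size d)%N sz => // k _; rewrite maxnE subn1/= add1n.
- by move=> z /tP[]; rewrite last_rcons.
Qed.

(** On the interval f' keeps its sign and has modulus at least 3m/4, so moving by r in either
    direction changes f by at least 3mr/4, more than |f z|. The values at the two ends have opposite
    signs. *)
Lemma zero_near f df z r m : 0 < r -> 0 < m ->
  {within `[z - r, z + r], continuous f} ->
  {in `]z - r, z + r[, forall x, is_derive x 1 f (df x)} ->
  {in `[z - r, z + r], forall x, `|df x - df z| <= m / 4} ->
  m <= `|df z| -> `|f z| <= m * r / 2 ->
  exists2 z', z' \in `[z - r, z + r] & f z' = 0.
Proof.
move=> r0 m0 fc fd dfz mz fz; have zr : z - r < z by lra.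
have rz : z < z + r by lra.
apply: IVT => //; first by lra.
have subl x : x \in `]z - r, z[ -> x \in `]z - r, z + r[.
  by rewrite !in_itv/= => /andP[-> /lt_trans->].
have subr x : x \in `]z, z + r[ -> x \in `]z - r, z + r[.
  by rewrite !in_itv/= => /andP[/(lt_trans zr)-> ->].
have [x /subl xz fx] := @MVT _ f df _ _ zr (fun y yz => fd y (subl y yz))
  (continuous_within_subitv (lexx _) (ltW rz) fc).
have [y /subr yz fy] := @MVT _ f df _ _ rz (fun y yz => fd y (subr y yz))
  (continuous_within_subitv (ltW zr) (lexx _) fc).
have := dfz x (subset_itv_oo_cc xz); have := dfz y (subset_itv_oo_cc yz).
have mr : 0 < m * r by rewrite mulr_gt0.
move: fx fy fz; have -> : z - (z - r) = r by ring.
have -> : z + r - z = r by ring.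
rewrite !ler_norml; move: (f (z - r)) (f (z + r)) (f z) (df x) (df y) (df z) mz mr r0 => u v w dx dy dz.
clear => mz mr r0 fx fy /andP[z1 z2] /andP[y1 y2] /andP[x1 x2].
rewrite ge_min le_max; apply/andP.
move: mz; have [dz0|dz0] := leP 0 dz; rewrite ?(ger0_norm dz0) ?(ltr0_norm dz0) => mz.
  have hx : (m * (3 / 4)) * r <= dx * r by rewrite ler_pM2r//; lra.
  have hy : (m * (3 / 4)) * r <= dy * r by rewrite ler_pM2r//; lra.
  by split; apply/orP; [left|right]; lra.
have hx : dx * r <= - (m * (3 / 4)) * r by rewrite ler_pM2r//; lra.
have hy : dy * r <= - (m * (3 / 4)) * r by rewrite ler_pM2r//; lra.
by split; apply/orP; [right|left]; lra.
Qed.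

(* If [g] is C^1-close to [f], the zeros of [g] are [delta]-separated, because
   [f] and [f'] are not small simultaneously, and each of them is within
   [delta / 4] of a zero of [f]. *)
Lemma perturbed_zeros f df ddf e :
  dirichlet_C2 f df ddf -> (exists M, {in `]0, 1[, forall x, `|ddf x| <= M}) ->
  0 < e -> {in `]0, 1[, forall x, e <= f x ^+ 2 + df x ^+ 2} ->
  exists2 eta : R, 0 < eta & forall g dg ddg c, dirichlet_C2 g dg ddg ->
    {in `]0, 1[, forall x, `|g x - f x| <= eta /\ `|dg x - df x| <= eta} ->
    uniq c -> zeros_in g c ->
    exists t, [/\ uniq t, size t = size c & zeros_in f t].
Proof.
move=> fC2 [M0 ddfM0] e0 fe; have [fc fd fdd _ [f0 f1]] := fC2.
have [N N0 [_ dfN]] := dirichlet_C2_bounded fC2.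
pose B := 1 + N + `|M0|.
have B0 : 0 < B by rewrite /B ltr_wpDr// ltr_wpDr.
have dfB : {in `]0, 1[, forall x, `|df x| <= B}.
  by move=> x /dfN; have := normr_ge0 M0; rewrite /B; lra.
have ddfB : {in `]0, 1[, forall x, `|ddf x| <= B}.
  by move=> x /ddfM0; have := ler_norm M0; rewrite /B; lra.
(* As m <= 1, |z| < m implies z^2 <= m <= e / 4; so f and f' cannot both be smaller than m in
   modulus. *)
pose m := Num.min 1 (e / 4).
have m0 : 0 < m by rewrite lt_min ltr01 divr_gt0.
have mP x : x \in `]0, 1[ -> `|f x| < m -> m <= `|df x|.
  move=> x01 fm; rewrite leNgt; apply/negP => dfm.
  have m1 : m <= 1 by rewrite ge_min lexx.
  have me : m <= e / 4 by rewrite ge_min lexx orbT.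
  have sq z : `|z| < m -> z ^+ 2 <= e / 4.
    move=> zm; rewrite -real_normK ?num_real// expr2; apply: le_trans me.
    by rewrite -[m]mulr1 ler_pM// ?ltW// (lt_le_trans zm).
  by have := fe x x01; have := sq _ fm; have := sq _ dfm; lra.
(* [B] bounds f' and f'', so over a distance [delta] both f and f' vary by at most m / 4. *)
pose delta := m / (4 * B).
have delta0 : 0 < delta by rewrite divr_gt0// mulr_gt0.
have Bdelta : B * delta = m / 4 by rewrite /delta; field; rewrite gt_eqF.
(* The first bound serves the separation of zeros. The second serves [zero_near] with radius delta /
   4, which tolerates |f z| up to m delta / 8. *)
pose eta := Num.min (m / 4) (m * delta / 16).
have eta0 : 0 < eta by rewrite lt_min !divr_gt0// mulr_gt0.
have eta4 : eta <= m / 4 by rewrite ge_min lexx.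
have eta16 : eta <= m * delta / 16 by rewrite ge_min lexx orbT.
exists eta => // g dg ddg c [gc gd _ _ [g0 g1]] gf uc c0.
have f_lip := lipschitz_of_bounded_derivative fc fd dfB.
have gfc x : x \in `[0, 1] -> `|g x - f x| <= eta.
  rewrite in_itv/= => /andP[]; rewrite le_eqVlt => /predU1P[<- _|x0].
    by rewrite g0 f0 subrr normr0 ltW.
  rewrite le_eqVlt => /predU1P[->|x1]; first by rewrite g1 f1 subrr normr0 ltW.
  by have [] := gf x; rewrite // in_itv/= x0.
have near_zero z : z \in `[0, 1] -> g z = 0 -> `|f z| <= eta.
  by move=> /gfc + gz; rewrite gz sub0r normrN.
have sep z z' : z \in `[0, 1] -> z' \in `[0, 1] -> g z = 0 -> g z' = 0 ->
    z < z' -> delta <= z' - z.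
  move=> z01 z'01 gz gz' zz'; rewrite leNgt; apply/negP => lt_delta.
  have [zx zy] : 0 <= z /\ z' <= 1.
    by move: z01 z'01; rewrite !in_itv/= => /andP[-> _] /andP[_ ->].
  have sub x : x \in `]z, z'[ -> x \in `]0, 1[.
    by rewrite !in_itv/= => /andP[/(le_lt_trans zx)-> /lt_le_trans->].
  have [x xzz' dgx] : exists2 x, x \in `]z, z'[ & is_derive x 1 g 0.
    apply: Rolle => //; last by rewrite gz gz'.
      by move=> x /sub/gd gdx; exact: (@ex_derive _ _ _ _ _ _ _ gdx).
    exact: (continuous_within_subitv zx zy gc).
  have x01 := sub x xzz'.
  have dg0 : dg x = 0.
    by rewrite -(@derive_val _ _ _ _ _ _ _ (gd x x01)) (@derive_val _ _ _ _ _ _ _ dgx).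
  have [_] := gf x x01; rewrite dg0 sub0r normrN => dfx.
  have fx : `|f x| < m.
    have := f_lip z x z01 (subset_itv_oo_cc x01).
    have := lerB_dist (f x) (f z).
    have : B * `|x - z| <= m / 4.
      rewrite -Bdelta ler_pM2l//; move: xzz'; rewrite in_itv/= => /andP[zx' xz'].
      by rewrite ger0_norm ?subr_ge0 ?ltW//; lra.
    by have := near_zero z z01 gz; lra.
  by have := mP x x01 fx; lra.
have close z : z \in c -> exists2 z', (z' \in `]0, 1[) /\ f z' = 0 & `|z' - z| <= delta / 4.
  move=> /c0[z01 gz].
  have z01' := subset_itv_oo_cc z01.
  (* The end points are zeros of [g] as well, so the separation applies to them and keeps the window
     around [z] inside (0, 1). *)
  have [zl zr] : delta <= z /\ delta <= 1 - z.
    move: (z01); rewrite in_itv/= => /andP[z0 z1]; split.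
      by rewrite -[z]subr0; apply: sep; rewrite // in_itv/= lexx ler01.
    by apply: sep; rewrite // in_itv/= lexx ler01.
  have fz := near_zero z z01' gz.
  have dfz : m <= `|df z| by apply: mP => //; lra.
  pose a := z - delta / 4; pose b := z + delta / 4.
  have ab : a <= b by rewrite /a /b; lra.
  have sub x : x \in `[a, b] -> x \in `]0, 1[.
    by rewrite !in_itv/= /a /b => /andP[? ?]; apply/andP; split; lra.
  have fabc : {within `[a, b], continuous f}.
    by apply: (continuous_within_subitv _ _ fc); rewrite /a /b; lra.
  have dfab x : x \in `[a, b] -> `|df x - df z| <= m / 4.
    move=> xab.
    have dfabc : {within `[a, b], continuous df}.
      apply: derivable_within_continuous => y /sub/fdd dfy.
      exact: (@ex_derive _ _ _ _ _ _ _ dfy).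
    have := @lipschitz_of_bounded_derivative _ df ddf a b B dfabc
      (fun y yab => fdd y (sub y (subset_itv_oo_cc yab)))
      (fun y yab => ddfB y (sub y (subset_itv_oo_cc yab))) z x.
    rewrite xab in_itv/= /a /b => /(_ _ isT)/le_trans; apply.
      by apply/andP; split; lra.
    rewrite -Bdelta ler_pM2l//; move: xab; rewrite in_itv/= /a /b ler_norml.
    by move=> /andP[? ?]; apply/andP; split; lra.
  have [z' z'ab fz'] : exists2 z', z' \in `[a, b] & f z' = 0.
    apply: (@zero_near f df z (delta / 4) m) => //.
    - by rewrite divr_gt0.
    - by move=> x /subset_itv_oo_cc/sub/fd.
    - by rewrite (le_trans fz)// (le_trans eta16)//; lra.
  exists z'; first by split => //; exact: sub.
  move: z'ab; rewrite in_itv/= /a /b ler_norml => /andP[? ?].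
  by apply/andP; split; lra.
have /choice[h hP] : forall z, exists z', z \in c ->
    [/\ z' \in `]0, 1[, f z' = 0 & `|z' - z| <= delta / 4].
  move=> z; have [/close[z' [? ?] ?]|_] := boolP (z \in c); last by exists 0.
  by exists z'.
exists (map h c); split; last 2 first.
- by rewrite size_map.
- by move=> _ /mapP[z /hP[? ? _] ->].
have hlt z z' : z \in c -> z' \in c -> z < z' -> h z < h z'.
  move=> zc z'c zz'; have [_ _] := hP z zc; have [_ _] := hP z' z'c.
  have [z01 gz] := c0 z zc; have [z'01 gz'] := c0 z' z'c.
  have := sep z z' (subset_itv_oo_cc z01) (subset_itv_oo_cc z'01) gz gz' zz'.
  by rewrite !ler_norml => ? /andP[? ?] /andP[? ?]; lra.
rewrite map_inj_in_uniq// => z z' zc z'c hzz'.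
have [zz'|z'z|//] := ltgtP z z'.
  by have := hlt _ _ zc z'c zz'; rewrite hzz' ltxx.
by have := hlt _ _ z'c zc z'z; rewrite hzz' ltxx.
Qed.

End Zeros.

(** * Integrals over the unit interval *)

Section UnitIntervalIntegral.
Set Implicit Arguments.
Unset Strict Implicit.
Unset Printing Implicit Defensive.
Variable R : realType.
Local Notation mu := (@lebesgue_measure R).
Local Notation I01 := (`[0, 1]%classic : set R).
Local Notation I01oo := (`]0, 1[%classic : set R).
Implicit Types (f g F dF : R -> R) (k x y z M : R) (zs : seq R).

(** A class closed under sums and products, containing the step functions and contained in $L^1$ and
    $L^2$ of the interval, so that integrability never has to be argued case by case. *)
Definition bounded_measurable f : Prop :=
  measurable_fun I01 f /\ exists M, {in `[0, 1], forall x, `|f x| <= M}.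

Definition integral01 f : R := \int[mu]_(x in I01) f x.

Lemma bounded_measurable_continuous f :
  {within `[0, 1], continuous f} -> bounded_measurable f.
Proof.
move=> fc; split; first exact: subspace_continuous_measurable_fun.
by have [M _ fM] := bounded_on_segment ler01 fc; exists M.
Qed.

Lemma bounded_measurable_cst k : bounded_measurable (fun=> k).
Proof. by split; [exact: measurable_cst|exists `|k|]. Qed.

Lemma bounded_measurableD f g : bounded_measurable f -> bounded_measurable g ->
  bounded_measurable (fun x => f x + g x).
Proof.
move=> [mf [M fM]] [mg [N gN]]; split; first exact: measurable_funD.
exists (M + N) => x x01; apply: le_trans (ler_normD _ _) _.
by rewrite lerD// ?fM ?gN.
Qed.

Lemma bounded_measurableM f g : bounded_measurable f -> bounded_measurable g ->
  bounded_measurable (fun x => f x * g x).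
Proof.
move=> [mf [M fM]] [mg [N gN]]; split; first exact: measurable_funM.
by exists (M * N) => x x01; rewrite normrM ler_pM// ?fM ?gN.
Qed.

Lemma bounded_measurable_scale k f : bounded_measurable f ->
  bounded_measurable (fun x => k * f x).
Proof. exact/bounded_measurableM/bounded_measurable_cst. Qed.

Lemma bounded_measurableB f g : bounded_measurable f -> bounded_measurable g ->
  bounded_measurable (fun x => f x - g x).
Proof.
move=> bf /(bounded_measurable_scale (-1)) /(bounded_measurableD bf).
by congr bounded_measurable; apply/funext => x; rewrite mulN1r.
Qed.

Lemma bounded_measurable_sum (I : Type) (r : seq I) (f : I -> R -> R) :
  (forall i, bounded_measurable (f i)) ->
  bounded_measurable (fun x => \sum_(i <- r) f i x).
Proof.
move=> bf; elim: r => [|i r IH].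
  have := bounded_measurable_cst 0; congr bounded_measurable.
  by apply/funext => x; rewrite big_nil.
have := bounded_measurableD (bf i) IH; congr bounded_measurable.
by apply/funext => x; rewrite big_cons.
Qed.

Lemma bounded_measurable_lt z : bounded_measurable (fun x => (x < z)%R%:R).
Proof.
split; last by exists 1 => x _; rewrite normr_nat lern1 leq_b1.
have -> : (fun x => (x < z)%R%:R) = \1_(`]-oo, z[%classic : set R) :> (R -> R).
  apply/funext => x; rewrite indicE; congr (_%:R).
  by congr nat_of_bool; apply/idP/idP; rewrite inE/= in_itv/=.
exact: measurable_indic.
Qed.

Lemma bounded_measurable_integrable f : bounded_measurable f ->
  mu.-integrable I01 (EFin \o f).
Proof.
move=> [mf [M fM]]; apply: measurable_bounded_integrable => //.
  by rewrite /= lebesgue_measure_itv/= lte_fin ltr01 -EFinB ltry.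
exists M; split; first exact: num_real.
by move=> N MN x /= x01; rewrite (le_trans (fM x x01))// ltW.
Qed.

Lemma integral01D f g : bounded_measurable f -> bounded_measurable g ->
  integral01 (fun x => f x + g x) = integral01 f + integral01 g.
Proof. by move=> bf bg; apply: RintegralD => //; exact: bounded_measurable_integrable. Qed.

Lemma integral01Z k f : bounded_measurable f ->
  integral01 (fun x => k * f x) = k * integral01 f.
Proof. by move=> bf; apply: RintegralZl => //; exact: bounded_measurable_integrable. Qed.

Lemma integral01B f g : bounded_measurable f -> bounded_measurable g ->
  integral01 (fun x => f x - g x) = integral01 f - integral01 g.
Proof. by move=> bf bg; apply: RintegralB => //; exact: bounded_measurable_integrable. Qed.

Lemma integral01_sum (I : Type) (r : seq I) (f : I -> R -> R) :
  (forall i, bounded_measurable (f i)) ->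
  integral01 (fun x => \sum_(i <- r) f i x) = \sum_(i <- r) integral01 (f i).
Proof.
move=> bf; elim: r => [|i r IH].
  rewrite big_nil; under [X in integral01 X]eq_fun do rewrite big_nil.
  by rewrite /integral01 Rintegral_cst// mul0r.
rewrite big_cons -IH -integral01D//; last exact: bounded_measurable_sum.
by congr integral01; apply/funext => x; rewrite big_cons.
Qed.

Lemma integral01_oo f : bounded_measurable f ->
  (\int[mu]_(x in I01oo) (f x)%:E)%E = (integral01 f)%:E.
Proof.
move=> bf; have intf := bounded_measurable_integrable bf.
rewrite /integral01 /Rintegral fineK; last exact: integrable_fin_num.
rewrite [RHS](@integral_itv_bndoo _ _ _ (EFin \o f))//.
by apply/measurable_EFinP; apply: measurable_funS bf.1 => //; exact: subset_itv_oo_cc.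
Qed.

Lemma L2_inner_integral01 f g : bounded_measurable f -> bounded_measurable g ->
  L2_inner f g = integral01 (fun x => f x * g x).
Proof.
by move=> bf bg; rewrite /L2_inner /Rintegral integral01_oo//; exact: bounded_measurableM.
Qed.

Lemma square_integrable_bounded f : bounded_measurable f -> square_integrable f.
Proof.
move=> bf; have b2 := bounded_measurableM bf bf.
split; first by apply: measurable_funS bf.1 => //; exact: subset_itv_oo_cc.
have intf := bounded_measurable_integrable b2.
have -> : (fun x => (f x ^+ 2)%:E) = EFin \o (fun x => f x * f x).
  by apply/funext => x /=; rewrite expr2.
by apply: integrableS intf => //; exact: subset_itv_oo_cc.
Qed.

(** Only [g] is integrated: F minus the primitive of [g] is continuous with nonnegative derivative
    off the finite list, hence nondecreasing. *)
Lemma integral01_le_increment F dF g zs :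
  {within `[0, 1], continuous F} ->
  (forall x, x \in `]0, 1[ -> x \notin zs -> is_derive x 1 F (dF x)) ->
  (forall x, x \in `]0, 1[ -> x \notin zs -> g x <= dF x /\ {for x, continuous g}) ->
  bounded_measurable g -> integral01 g <= F 1 - F 0.
Proof.
move=> Fc Fd gF bg; have intg := bounded_measurable_integrable bg.
pose G x := \int[mu]_(t in `[0%R, x]) g t.
have Gc : {within `[0, 1], continuous G}.
  exact: parameterized_integral_continuous ler01 intg.
have Gd x : x \in `]0, 1[ -> x \notin zs -> is_derive x 1 G (g x).
  move=> x01 xzs; have [_ gx] := gF x x01 xzs.
  move: x01; rewrite in_itv/= => /andP[x0 x1].
  have [dG GE] : derivable G x 1 /\ derive1 G x = g x.
    exact: continuous_FTC1_closed x1 intg x0 gx.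
  by apply: DeriveDef; [exact: dG|rewrite -derive1E GE].
have FGd x : x \in `]0, 1[ -> x \notin zs ->
    is_derive x 1 (fun t => F t + -1 * G t) (dF x + -1 * g x).
  by move=> x01 xzs; apply: is_derive_add (Fd x x01 xzs) (is_derive_scale _ (Gd x x01 xzs)).
have : F 0 + -1 * G 0 <= F 1 + -1 * G 1.
  apply: (@nondecreasing_except _ (fun t => F t + -1 * G t) _ 0 1 zs ler01 _ FGd).
    by move=> x; apply: cvgD; [exact: Fc|apply: cvgM; [exact: cvg_cst|exact: Gc]].
  by move=> x x01 xzs; have [] := gF x x01 xzs; lra.
have -> : G 0 = 0 by rewrite /G set_itv1 Rintegral_set1.
rewrite -/(integral01 g); have -> : G 1 = integral01 g by [].
lra.
Qed.

(** The primitive of [f] lies between 0 and the total integral 0, so it vanishes on (0, 1), and its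
    derivative at a continuity point is the value of [f]. *)
Lemma integral01_eq0 f x : bounded_measurable f -> {in `[0, 1], forall y, 0 <= f y} ->
  integral01 f = 0 -> x \in `]0, 1[ -> {for x, continuous f} -> f x = 0.
Proof.
move=> bf f0 If x01 fx; have intf := bounded_measurable_integrable bf.
pose G y := \int[mu]_(t in `[0%R, y]) f t.
have G0 y : y \in `]0, 1[ -> G y = 0.
  rewrite in_itv/= => /andP[y0 y1]; apply/eqP; rewrite eq_le; apply/andP; split.
    have := @Rintegral_itvB _ f (BLeft 0) (BRight 1) y intf.
    rewrite !bnd_simp => /(_ (ltW y0) (ltW y1)).
    rewrite -/(integral01 f) If sub0r -/(G y) => GE.
    rewrite -oppr_ge0 GE; apply: Rintegral_ge0 => z /=; rewrite in_itv/= => /andP[yz z1].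
    by apply: f0; rewrite in_itv/= z1 (le_trans (ltW y0) (ltW yz)).
  apply: Rintegral_ge0 => z /=; rewrite in_itv/= => /andP[z0 zy].
  by apply: f0; rewrite in_itv/= z0 (le_trans zy (ltW y1)).
move: (x01); rewrite in_itv/= => /andP[x0 x1].
have [_ <-] : derivable G x 1 /\ derive1 G x = f x.
  exact: continuous_FTC1_closed x1 intf x0 fx.
rewrite derive1E -(@derive_val _ _ _ _ _ _ _ (is_derive_cst 0 x 1)).
apply: near_eq_derive; near=> y; rewrite G0//.
by near: y; exact: near_in_itvoo.
Unshelve. all: by end_near. Qed.

End UnitIntervalIntegral.

(** * The energy of a truncated eigenfunction *)

Section CourantBound.
Set Implicit Arguments.
Unset Strict Implicit.
Unset Printing Implicit Defensive.
Variable R : realType.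
Implicit Types (f df g P dP Q s q : R -> R) (k x y z mu K : R) (c : seq R).

(* With r = s f - P, integrate the derivative of
   s^2 f f' - 2 s f P' + P P', which vanishes at 0 and 1; it equals
   (s f' - P')^2 + (q + K) r^2 plus the integrand below. *)
Lemma truncated_energy f df P dP Q s q K mu c :
  dirichlet_C2 f df (fun x => (q x - mu) * f x) ->
  dirichlet_C2 P dP (fun x => q x * P x - Q x) ->
  {in `]0, 1[, forall x, {for x, continuous Q}} -> bounded_measurable Q ->
  {in `]0, 1[, forall x, - K <= q x} ->
  bounded_measurable s ->
  (forall x, x \notin c -> \forall y \near x, s y = s x) ->
  {in c, forall x, f x = 0} ->
  integral01 (fun x => (2 * (s x * f x) - P x) * (Q x - mu * P x)
    - (K + mu) * ((s x * f x - P x) * (s x * f x - P x))) <= 0.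
Proof.
move=> fC2 PC2 Qc bQ qK bs sloc fc0.
have [fc fd fdd _ [f0 f1]] := fC2; have [Pc Pd Pdd _ [P0 P1]] := PC2.
have [Mf Mf0 [fM dfM]] := dirichlet_C2_bounded fC2.
have [MP MP0 [PM dPM]] := dirichlet_C2_bounded PC2.
have [_ [Ms sM]] := bs.
have Ms0 : 0 <= Ms by apply: le_trans (sM 0 _); rewrite // in_itv/= lexx ler01.
(* Factoring [f] out of the terms that contain [s] makes [T] continuous at the jumps: they are zeros
   of [f], and [v] is bounded. [dv] treats [s] as a constant, which it is locally off [c]. *)
pose v x := s x * (s x * df x + -2 * dP x).
pose dv x := s x * (s x * ((q x - mu) * f x) + -2 * (q x * P x - Q x)).
pose T x := f x * v x + P x * dP x.
pose dT x := df x * v x + f x * dv x + (dP x * dP x + P x * (q x * P x - Q x)).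
have s'0 x : x \notin c -> is_derive x 1 s 0.
  move=> /sloc sx; apply: near_eq_is_derive (is_derive_cst (s x) x 1).
  by near=> y; apply/esym; near: y.
have vd x : x \in `]0, 1[ -> x \notin c -> is_derive x 1 v (dv x).
  move=> x01 xc; have sx := s'0 x xc.
  have := is_derive_mul sx (is_derive_add (is_derive_mul sx (fdd x x01))
    (is_derive_scale (-2) (Pdd x x01))).
  by congr is_derive; rewrite /dv; ring.
have Td x : x \in `]0, 1[ -> x \notin c -> is_derive x 1 T (dT x).
  move=> x01 xc; exact: is_derive_add (is_derive_mul (fd x x01) (vd x x01 xc))
    (is_derive_mul (Pd x x01) (Pdd x x01)).
have vM : {in `]0, 1[, forall x, `|v x| <= Ms * (Ms * Mf + 2 * MP)}.
  move=> x x01; have xcc := subset_itv_oo_cc x01.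
  rewrite normrM ler_pM ?sM//; apply: le_trans (ler_normD _ _) _.
  apply: lerD; first by rewrite normrM ler_pM ?sM ?dfM.
  by rewrite mulNr normrN normrM normr_nat ler_wpM2l// dPM.
have Tc : {within `[0, 1], continuous T}.
  move=> x; apply: cvgD.
    apply: (continuous_mul_vanishing fc f0 f1 _ vM) => z z01.
    have [/fc0|zc] := boolP (z \in c); first by left.
    right; exact: is_derive_continuous (vd z z01 zc).
  apply: (continuous_mul_vanishing Pc P0 P1 _ dPM) => z z01.
  right; exact: is_derive_continuous (Pdd z z01).
have -> : 0 = T 1 - T 0 by rewrite /T f0 f1 P0 P1 !mul0r addr0 subrr.
have bf := bounded_measurable_continuous fc.
have bP := bounded_measurable_continuous Pc.
have bsf := bounded_measurableM bs bf.
apply: (integral01_le_increment Tc Td); last first.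
  apply: bounded_measurableB; first apply: bounded_measurableM.
  - exact/bounded_measurableB/bP/bounded_measurable_scale.
  - exact/bounded_measurableB/bounded_measurable_scale.
  - apply/bounded_measurable_scale/bounded_measurableM; exact: bounded_measurableB.
move=> x x01 xc; split.
  rewrite -subr_ge0.
  have -> : dT x - ((2 * (s x * f x) - P x) * (Q x - mu * P x)
      - (K + mu) * ((s x * f x - P x) * (s x * f x - P x))) =
    (s x * df x - dP x) ^+ 2 + (q x + K) * (s x * f x - P x) ^+ 2.
    by rewrite /dT /v /dv; ring.
  apply: addr_ge0; first exact: sqr_ge0.
  apply: mulr_ge0; last exact: sqr_ge0.
  by rewrite -lerBlDr sub0r qK.
have fx : {for x, continuous f} := is_derive_continuous (fd x x01).
have Px : {for x, continuous P} := is_derive_continuous (Pd x x01).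
have sx : {for x, continuous s} := is_derive_continuous (s'0 x xc).
have sfx : (fun t => s t * f t) @ x --> s x * f x by apply: cvgM.
apply: cvgB; first apply: cvgM.
- by apply: cvgB Px; apply: cvgM sfx; exact: cvg_cst.
- by apply: cvgB; [exact: Qc|apply: cvgM; [exact: cvg_cst|exact: Px]].
- apply: cvgM; first exact: cvg_cst.
  by apply: cvgM; apply: cvgB.
Unshelve. all: by end_near. Qed.

(** Built from half-line indicators, such a function is 0 to the right of the last node. With
    distinct nodes in (0, 1), the only constant one on the interval is thus 0, although there are as
    many free coefficients as nodes. *)
Definition step_fun n (alpha : 'rV[R]_n) (z : 'I_n -> R) x : R :=
  \sum_(i < n) alpha 0 i * (x < z i)%R%:R.

Lemma step_fun_bounded_measurable n (alpha : 'rV[R]_n) (z : 'I_n -> R) :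
  bounded_measurable (step_fun alpha z).
Proof.
apply: bounded_measurable_sum => i.
exact/bounded_measurable_scale/bounded_measurable_lt.
Qed.

Lemma step_fun_locally_constant n (alpha : 'rV[R]_n) (z : 'I_n -> R) x :
  (forall i, x != z i) -> \forall y \near x, step_fun alpha z y = step_fun alpha z x.
Proof.
move=> xz.
have H : \forall y \near x, forall i, (y < z i) = (x < z i).
  apply: (@filter_forall _ _ (fun i y => (y < z i) = (x < z i)) (nbhs x)
    (nbhs_filter x)) => i.
  have [xi|ix|xi] := ltgtP x (z i).
  - by apply: filterS (lt_nbhsl xi) => y ->.
  - by apply: filterS (lt_nbhsr ix) => y iy; apply/negbTE; rewrite -leNgt ltW.
  - by have := xz i; rewrite xi eqxx.
by apply: filterS H => y H; apply: eq_bigr => i _; rewrite H.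
Qed.

(** The coefficient [alpha 0 i] is, up to sign, the jump across [z i]. The value [a] is only known
    on a dense set because an equation between multiples of $h_m$ can be divided only where $h_m$ is
    nonzero. *)
Lemma step_fun_const_eq0 n (alpha : 'rV[R]_n) (z : 'I_n -> R) (a : R) :
  injective z -> (forall i, z i \in `]0, 1[) ->
  (forall x y, 0 <= x -> x < y -> y <= 1 ->
    exists2 t, t \in `]x, y[ & step_fun alpha z t = a) -> alpha = 0.
Proof.
move=> zinj z01 sa; apply/rowP => i; rewrite mxE.
have /andP[zi0 zi1] : 0 < z i < 1 by have := z01 i; rewrite in_itv.
(* [l] and [r] are the neighbouring nodes of [z i], with 0 and 1 as defaults; between them only the
   i-th term changes. *)
pose l := \big[Num.max/0]_(k | z k < z i) z k.
pose r := \big[Num.min/1]_(k | z i < z k) z k.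
have lz : l < z i by apply: bigmax_lt.
have zr : z i < r by apply: lt_bigmin.
have l0 : 0 <= l by exact: bigmax_ge_id.
have r1 : r <= 1 by exact: bigmin_le_id.
have [x xl sx] := sa l (z i) l0 lz (ltW zi1).
have [y yr sy] := sa (z i) r (ltW zi0) zr r1.
move: xl yr; rewrite !in_itv/= => /andP[lx xz] /andP[zy yr].
have : step_fun alpha z x - step_fun alpha z y = 0 by rewrite sx sy subrr.
rewrite /step_fun -sumrB (bigD1 i)//= big1 ?addr0.
  by rewrite xz ltNge (ltW zy)/= mulr1 mulr0 subr0.
move=> k ki; rewrite -mulrBr.
have [zki|zik|/zinj E] := ltgtP (z k) (z i); last by rewrite E eqxx in ki.
- have kl : z k <= l by exact: le_bigmax_cond.
  rewrite !ltNge (le_trans kl (ltW lx)) (le_trans (ltW zki) (ltW zy))/=.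
  by rewrite subrr mulr0.
- have rk : r <= z k by exact: bigmin_le_cond.
  by rewrite (lt_trans xz zik) (lt_le_trans yr rk) subrr mulr0.
Qed.

End CourantBound.

(** * Courant's bound *)

Section CourantZeros.
Set Implicit Arguments.
Unset Strict Implicit.
Unset Printing Implicit Defensive.
Variables (R : realType) (q : R -> R) (lam : nat -> R) (h : nat -> R -> R).
Implicit Types (s w : R -> R) (x y K : R) (c : seq R) (m M : nat) (a : nat -> R).
Hypothesis hq : smooth_near_unit_interval q.
Hypothesis lam_lt : forall i j : nat, (i < j)%N -> lam i < lam j.
Hypothesis hh : forall j : nat, dirichlet_eigenfunction q (lam j) (h j).
Hypothesis hbasis : L2_orthonormal_basis h.

Let qc := (smooth_near_unit_continuous hq).1.

Let hC2 j := dirichlet_solution_C2 qc (hh j).1.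

Let bh j : bounded_measurable (h j).
Proof. by apply: bounded_measurable_continuous; have [] := hC2 j. Qed.

Let hcont j : {in `]0, 1[, forall x, {for x, continuous (h j)}}.
Proof. by move=> x x01; have [_ hd _ _ _] := hC2 j; exact: is_derive_continuous (hd x x01). Qed.

Let bhsum M (a : nat -> R) : bounded_measurable (fun x => \sum_(j < M) a j * h j x).
Proof. by apply: bounded_measurable_sum => i; exact: bounded_measurable_scale. Qed.

Let hsumC2 M a : dirichlet_C2 (fun x => \sum_(j < M) a j * h j x)
  (fun x => \sum_(j < M) a j * derive1 (h j) x)
  (fun x => \sum_(j < M) a j * ((q x - lam j) * h j x)).
Proof.
exact: (@dirichlet_C2_sum R _ (index_enum 'I_M) xpredT (fun j : 'I_M => a j) _ _ _
    (fun j : 'I_M => hC2 j)).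
Qed.

Let orth i j : integral01 (fun x => h i x * h j x) = (i == j)%:R.
Proof. by rewrite -L2_inner_integral01//; have [_ + _] := hbasis; apply. Qed.

Let inner_sum w M (a : nat -> R) : bounded_measurable w ->
  integral01 (fun x => w x * \sum_(j < M) a j * h j x) =
  \sum_(j < M) a j * L2_inner w (h j).
Proof.
move=> bw; rewrite (_ : (fun x => _) =
    (fun x => \sum_(j < M) a j * (w x * h j x))); last first.
  by apply/funext => x; rewrite mulr_sumr; apply: eq_bigr => j _; rewrite mulrCA.
rewrite integral01_sum; last first.
  by move=> j; apply: bounded_measurable_scale; exact: bounded_measurableM.
apply: eq_bigr => j _; rewrite integral01Z; last exact: bounded_measurableM.
by rewrite L2_inner_integral01.
Qed.

Let inner_h_sum M (a : nat -> R) (k : 'I_M) :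
  L2_inner (fun x => \sum_(j < M) a j * h j x) (h k) = a k.
Proof.
rewrite L2_inner_integral01//.
rewrite (_ : (fun x => _) = (fun x => h k x * \sum_(j < M) a j * h j x)); last first.
  by apply/funext => x; rewrite mulrC.
rewrite inner_sum// (bigD1 k)//= big1 ?addr0.
  by rewrite L2_inner_integral01// orth eqxx mulr1.
move=> j jk; rewrite L2_inner_integral01// orth.
by rewrite [_ == _ :> nat]eq_sym (inj_eq val_inj) (negbTE jk) mulr0.
Qed.

(** In [truncated_energy] take for P the M-th partial sum of the expansion of w, so that Q = -P'' +
    q P multiplies the coefficients by the eigenvalues. For k < M the k-th coefficient of 2 w - P is
    2 a_k - a_k = a_k, which produces the squares on the left. *)
Let energy_coefficients m s w a c K M :
  (forall x, w x = s x * h m x) -> (forall j, a j = L2_inner w (h j)) ->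
  {in `]0, 1[, forall x, - K <= q x} -> bounded_measurable s ->
  (forall x, x \notin c -> \forall y \near x, s y = s x) ->
  {in c, forall x, h m x = 0} ->
  \sum_(j < M) (lam j - lam m) * a j ^+ 2 <=
  (K + lam m) * integral01 (fun x => (w x - \sum_(j < M) a j * h j x) *
                                     (w x - \sum_(j < M) a j * h j x)).
Proof.
move=> /funext wE aE qK bs sloc c0; subst w; set w := (fun x => _) in aE *.
pose P x := \sum_(j < M) a j * h j x.
pose Q x := \sum_(j < M) (a j * lam j) * h j x.
pose D x := \sum_(j < M) (a j * (lam j - lam m)) * h j x.
have bw : bounded_measurable w by exact: bounded_measurableM.
have bP : bounded_measurable P by exact: bhsum.
have PC2 : dirichlet_C2 P (fun x => \sum_(j < M) a j * derive1 (h j) x)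
    (fun x => q x * P x - Q x).
  have := hsumC2 M a.
  congr dirichlet_C2; apply/funext => x; rewrite /P /Q mulr_sumr -sumrB.
  by apply: eq_bigr => j _; ring.
have Qc : {in `]0, 1[, forall x, {for x, continuous Q}}.
  have [_ Qd _ _ _] := hsumC2 M (fun j => a j * lam j).
  by move=> x x01; exact: is_derive_continuous (Qd x x01).
have := truncated_energy (hC2 m) PC2 Qc (bhsum _ (fun j => a j * lam j)) qK bs sloc c0.
have DE x : Q x - lam m * P x = D x.
  rewrite /Q /P /D mulr_sumr -sumrB; apply: eq_bigr => j _; ring.
under [X in integral01 X]eq_fun do rewrite DE.
have b2 : bounded_measurable (fun x => 2 * w x - P x).
  exact/bounded_measurableB/bP/bounded_measurable_scale.
have bD : bounded_measurable D := bhsum M (fun j => a j * (lam j - lam m)).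
have br : bounded_measurable (fun x => w x - P x) by exact: bounded_measurableB.
rewrite integral01B; last 2 first.
- exact: bounded_measurableM b2 bD.
- by apply: bounded_measurable_scale; exact: (bounded_measurableM br br).
rewrite integral01Z; last exact: (bounded_measurableM br br).
rewrite subr_le0 => H; apply: le_trans H.
rewrite (inner_sum _ (fun j => a j * (lam j - lam m)) b2).
rewrite le_eqVlt; apply/orP; left; apply/eqP; apply: eq_bigr => k _.
have -> : L2_inner (fun x => 2 * w x - P x) (h k) = a k; last by ring.
rewrite L2_inner_integral01// (_ : (fun x => _) =
    (fun x => 2 * (w x * h k x) - P x * h k x)); last first.
  by apply/funext => x; ring.
rewrite integral01B; last 2 first.
- exact/bounded_measurable_scale/bounded_measurableM.
- exact: bounded_measurableM.
rewrite integral01Z -?L2_inner_integral01//; last exact: bounded_measurableM.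
by rewrite inner_h_sum -aE; ring.
Qed.

Let remainder_cvg0 w : bounded_measurable w ->
  (fun M => integral01 (fun x => (w x - \sum_(j < M) L2_inner w (h j) * h j x) *
                                 (w x - \sum_(j < M) L2_inner w (h j) * h j x)))
    @ \oo --> 0.
Proof.
move=> bw; have [_ _ complete] := hbasis.
have := complete w (square_integrable_bounded bw).
move=> /fine_cvg; apply: cvg_trans; apply: near_eq_cvg; near=> M.
have br : bounded_measurable (fun x => w x - \sum_(j < M) L2_inner w (h j) * h j x).
  exact: (bounded_measurableB bw (bhsum M (fun j => L2_inner w (h j)))).
have E := congr1 fine (integral01_oo (bounded_measurableM br br)).
rewrite /= in E; rewrite -E /=.
by congr fine; apply: eq_integral => x _; rewrite expr2.
Unshelve. all: by end_near. Qed.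

(* Courant: otherwise a nonzero function s h_m, with s a step function jumping
   at zeros of h_m, would be orthogonal to h_0, ..., h_(m-1); its energy forces
   it to be a multiple of h_m. *)
Lemma eigenfunction_zeros_le m c : uniq c -> zeros_in (h m) c -> (size c <= m)%N.
Proof.
move=> uc c0; rewrite leqNgt; apply/negP => mc.
pose z (i : 'I_m.+1) := c`_i.
have zlt (i : 'I_m.+1) : (i < size c)%N := leq_trans (ltn_ord i) mc.
have zc i : z i \in c by rewrite mem_nth.
have zinj : injective z.
  by move=> i j /eqP; rewrite nth_uniq// => /eqP/val_inj.
pose A : 'M[R]_(m.+1, m) :=
  \matrix_(i, j) L2_inner (fun x => (x < z i)%R%:R * h m x) (h j).
(* There are m + 1 coefficients, one per chosen zero, and m orthogonality conditions. *)
have [alpha alphaA alpha0] : exists2 alpha : 'rV_m.+1, alpha *m A = 0 & alpha != 0.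
  have /rowV0Pn[v /sub_kermxP vA v0] : kermx A != 0; last by exists v.
  by rewrite -mxrank_eq0 mxrank_ker subn_eq0 -ltnNge ltnS rank_leq_col.
pose s := step_fun alpha z; pose w x := s x * h m x.
pose a j := L2_inner w (h j).
have bs : bounded_measurable s by exact: step_fun_bounded_measurable.
have bw : bounded_measurable w by exact: bounded_measurableM.
have sloc x : x \notin c -> \forall y \near x, s y = s x.
  move=> xc; apply: step_fun_locally_constant => i.
  by apply: contraNneq xc => ->.
have bu i : bounded_measurable (fun x => (x < z i)%R%:R * h m x).
  by apply: bounded_measurableM (bh m); exact: bounded_measurable_lt.
have aE j : a j = \sum_i alpha 0 i * L2_inner (fun x => (x < z i)%R%:R * h m x) (h j).
  rewrite /a L2_inner_integral01// (_ : (fun x => _) =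
    (fun x => \sum_i alpha 0 i * (((x < z i)%R%:R * h m x) * h j x))); last first.
    apply/funext => x; rewrite /w /s /step_fun !mulr_suml.
    by apply: eq_bigr => i _; rewrite !mulrA.
  rewrite integral01_sum; last first.
    by move=> i; apply: bounded_measurable_scale; exact: bounded_measurableM.
  apply: eq_bigr => i _; rewrite integral01Z; last exact: bounded_measurableM.
  by rewrite L2_inner_integral01.
have a_lt j : (j < m)%N -> a j = 0.
  move=> jm; rewrite aE.
  have := congr1 (fun B : 'rV_m => B 0 (Ordinal jm)) alphaA; rewrite !mxE => E.
  by apply: etrans E; apply: eq_bigr => i _; rewrite ?mxE.
have [K0 _ qK0] := bounded_on_segment ler01 qc.
have qK : {in `]0, 1[, forall x, - K0 <= q x}.
  by move=> x /subset_itv_oo_cc/qK0; rewrite ler_norml => /andP[].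
pose r M := integral01 (fun x => (w x - \sum_(j < M) a j * h j x) *
                                 (w x - \sum_(j < M) a j * h j x)).
have r0 : r @ \oo --> 0 by exact: remainder_cvg0.
have Kr M : \sum_(j < M) (lam j - lam m) * a j ^+ 2 <= (K0 + lam m) * r M.
  by apply: (@energy_coefficients m s w a c K0 M) => // x /c0[].
have terms_ge0 j : 0 <= (lam j - lam m) * a j ^+ 2.
  have [jm|mj] := ltnP j m; first by rewrite a_lt// expr0n mulr0.
  rewrite mulr_ge0 ?sqr_ge0// subr_ge0; move: mj.
  by rewrite leq_eqVlt => /predU1P[->//|/lam_lt/ltW].
(* Below m this is the choice of [alpha]. Above m, each term of the nonnegative sum is bounded by a
   multiple of the remainder [r M], which tends to 0, while the factor lam j - lam m is positive. *)
have a0 j : j != m -> a j = 0.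
  move=> jm; have [/a_lt//|mj] := ltnP j m.
  have {}mj : (m < j)%N by rewrite ltn_neqAle eq_sym jm.
  apply/eqP; rewrite -sqrf_eq0 -(mulrI_eq0 _ (lregP _ : GRing.lreg (lam j - lam m)));
    last by rewrite subr_eq0 gt_eqF// lam_lt.
  rewrite eq_le terms_ge0 andbT leNgt; apply/negP => t0.
  have Kr0 : (fun M => (K0 + lam m) * r M) @ \oo --> 0.
    by rewrite -(mulr0 (K0 + lam m)); apply: cvgM => //; exact: cvg_cst.
  have KrS := (cvgr0Pnorm_lt _).1 Kr0 _ t0.
  near \oo => M.
  have jM : (j < M)%N by near: M; exact: nbhs_infty_gt.
  have : `|(K0 + lam m) * r M| < (lam j - lam m) * a j ^+ 2 by near: M; exact: KrS.
  apply/negP; rewrite -leNgt; apply: le_trans (ler_norm _); apply: le_trans (Kr M).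
  rewrite (bigD1 (Ordinal jM))//= lerDl; apply: sumr_ge0 => i _; exact: terms_ge0.
(* Only the m-th coefficient survives, so w - a_m h_m has zero $L^2$ norm; off [c] it is continuous,
   which turns this into a pointwise equality. *)
have wE x : x \in `]0, 1[ -> x \notin c -> w x = a m * h m x.
  move=> x01 xc.
  pose g y := (w y - a m * h m y) * (w y - a m * h m y).
  have bg : bounded_measurable g.
    by apply: bounded_measurableM; apply: bounded_measurableB => //; exact: bounded_measurable_scale.
  have rE M : (m < M)%N -> r M = integral01 g.
    move=> mM; rewrite /r; congr integral01; apply/funext => y.
    suff -> : \sum_(j < M) a j * h j y = a m * h m y by [].
    rewrite (bigD1 (Ordinal mM))//= big1 ?addr0// => j jm.
    by rewrite a0 ?mul0r//; apply: contraNneq jm => E; apply/eqP/val_inj.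
  have Ig : integral01 g = 0.
    apply: (@cvg_unique _ (@norm_hausdorff _ R) (r @ \oo)) => //.
    apply: cvg_near_cst; near=> M; apply: rE; near: M; exact: nbhs_infty_gt.
  have gc : {for x, continuous g}.
    have wc : {for x, continuous w}.
      apply: cvgM; last exact: hcont.
      by apply: cvg_near_cst; exact: sloc.
    have ac : {for x, continuous (fun y => w y - a m * h m y)}.
      by apply: cvgB wc _; apply: cvgM; [exact: cvg_cst|exact: hcont].
    exact: (cvgM ac ac).
  have g0 y : y \in `[0, 1] -> 0 <= g y by move=> _; rewrite /g -expr2 sqr_ge0.
  have /eqP := integral01_eq0 bg g0 Ig x01 gc.
  by rewrite /g mulf_eq0 orbb subr_eq0 => /eqP.
suff : alpha = 0 by move/eqP; rewrite (negbTE alpha0).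
apply: (@step_fun_const_eq0 _ _ _ z (a m)) => // [i|x y x0 xy y1].
  by have [] := c0 _ (zc i).
have [t txy ht] := eigenfunction_neq0_dense qc (hh m) x0 xy y1.
exists t => //; apply: (mulIf ht); apply: wE.
  by move: txy; rewrite !in_itv/= => /andP[/(le_lt_trans x0)-> /lt_le_trans->].
by apply: contraNN ht => /c0[_ ->].
Unshelve. all: by end_near. Qed.

End CourantZeros.

(** * Linear combinations of eigenfunctions *)

(** Finiteness is part of the conclusion: an infinite set would contain a duplicate-free list of
    length k + 1. *)
Lemma card_le_uniq (T : choiceType) (A : set T) (k : nat) :
  (forall c : seq T, uniq c -> {in c, forall x, A x} -> (size c <= k)%N) ->
  (A #<= `I_k)%card.
Proof.
move=> H.
have finA : finite_set A.
  apply: contrapT => /(infinite_set_fset k.+1)[B BA].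
  by rewrite ltnNge (H _ (finmap.fset_uniq B))// => x xB; exact: BA.
have [m Am] := (finite_setP A).1 finA.
move: (Am); rewrite card_eq_le => /andP[le1 le2].
apply: card_le_trans le1 _; rewrite card_le_II.
apply: leq_trans (leq_card_fset_set finA le2) (H _ (finmap.fset_uniq _) _) => x xA.
by rewrite -(fset_setK finA).
Qed.

Section ChebyshevSystem.
Set Implicit Arguments.
Unset Strict Implicit.
Unset Printing Implicit Defensive.
Variables (R : realType) (q : R -> R) (lam : nat -> R) (h : nat -> R -> R).
Implicit Types (x y z : R) (c d : seq R) (n k : nat).
Hypothesis hq : smooth_near_unit_interval q.
Hypothesis lam_lt : forall i j : nat, (i < j)%N -> lam i < lam j.
Hypothesis hh : forall j : nat, dirichlet_eigenfunction q (lam j) (h j).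
Hypothesis hbasis : L2_orthonormal_basis h.

Let qc := (smooth_near_unit_continuous hq).1.

Let hC2 j := dirichlet_solution_C2 qc (hh j).1.

Definition lin_comb_deriv n (b : 'rV[R]_n) x : R :=
  \sum_(j < n) b 0 j * derive1 (h j) x.

Let zeros_le m c : uniq c -> zeros_in (h m) c -> (size c <= m)%N.
Proof. exact: (eigenfunction_zeros_le hq lam_lt hh hbasis). Qed.

Lemma lin_comb_C2 n (b : 'rV[R]_n) :
  dirichlet_C2 (lin_comb h b) (lin_comb_deriv b)
    (fun x => \sum_(j < n) b 0 j * ((q x - lam j) * h j x)).
Proof. exact: (dirichlet_C2_sum _ _ _ (fun j : 'I_n => hC2 j)). Qed.

(** Courant's bound with m = 0; it makes $h_0$ an admissible denominator in the Liouville step. *)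
Let h0_neq0 : {in `]0, 1[, forall x, h 0%N x != 0}.
Proof.
move=> x x01; apply/eqP => hx0.
have : zeros_in (h 0%N) [:: x] by move=> y; rewrite inE => /eqP ->.
by move/zeros_le => /(_ isT).
Qed.

Definition spectral_weight n (b : 'rV[R]_n) (w : nat -> R) : 'rV[R]_n :=
  \row_j (b 0 j * w j).

(** In $h_0S''-h_0''S$ the potential cancels and each mode keeps the factor lam 0 - lam j, so this
    is $-h_0$ times the reweighted combination, and $h_0$ can be divided out. The list [d] holds the
    double zeros. *)
Lemma lin_comb_liouville n (b : 'rV[R]_n) c d :
  uniq c -> zeros_in (lin_comb h b) c ->
  uniq d -> {subset d <= c} -> {in d, forall x, lin_comb_deriv b x = 0} ->
  exists t, [/\ uniq t, size t = (size c + size d)%N &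
    zeros_in (lin_comb h (spectral_weight b (fun j => lam j - lam 0%N))) t].
Proof.
move=> uc c0 ud dc d0.
have [t [ut st tP]] := liouville_step (hC2 0) (lin_comb_C2 b) h0_neq0 uc c0 ud dc d0.
exists t; split => // x /tP[x01 E]; split => //.
apply: (mulfI (h0_neq0 x01)); rewrite mulr0 -[RHS]oppr0 -[in RHS]E opprB.
rewrite /lin_comb !mulr_sumr -sumrB; apply: eq_bigr => j _.
by rewrite mxE; ring.
Qed.

Lemma lin_comb_liouville_iter n (b : 'rV[R]_n) c k :
  uniq c -> zeros_in (lin_comb h b) c ->
  exists t, [/\ uniq t, size t = size c &
    zeros_in (lin_comb h (spectral_weight b (fun j => (lam j - lam 0%N) ^+ k))) t].
Proof.
move=> uc c0; elim: k => [|k [t [ut st tP]]].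
  exists c; split => //; congr (zeros_in (lin_comb h _) c): c0.
  by apply/rowP => j; rewrite mxE expr0 mulr1.
have [u [uu su uP]] := @lin_comb_liouville _ _ t [::] ut tP isT
  (fun x (xn : x \in [::]) => False_ind _ (notF xn)) (fun x xn => False_ind _ (notF xn)).
exists u; split => //; first by rewrite su st addn0.
congr (zeros_in (lin_comb h _) u): uP.
by apply/rowP => j; rewrite !mxE exprSr mulrA.
Qed.

(* Repeated Liouville steps, normalized at the top mode m, converge to
   h_m in C^1. *)
Lemma lin_comb_zeros_lt n (b : 'rV[R]_n) c :
  b != 0 -> uniq c -> zeros_in (lin_comb h b) c -> (size c < n)%N.
Proof.
move=> b0 uc c0.
have [j0 bj0] : exists j0, b 0 j0 != 0 by apply/rV0Pn.
pose m := [arg max_(i > j0 | b 0%R i != 0%R) (i : nat)]%N.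
have [bm mmax] : b 0 m != 0 /\ forall j, b 0 j != 0 -> (j <= m)%N.
  by rewrite /m; case: arg_maxnP.
apply: leq_ltn_trans (ltn_ord m).
have [yc yd ydd _ _] := hC2 m.
have [e e0 he] := eigenfunction_energy_lower qc (hh m).
have ddM : exists M, {in `]0, 1[, forall x, `|(q x - lam m) * h m x| <= M}.
  have [Mq Mq0 qM] := bounded_on_segment ler01 qc.
  have [My My0 yM] := bounded_on_segment ler01 yc.
  exists ((Mq + `|lam m|) * My) => x /subset_itv_oo_cc x01.
  by rewrite normrM ler_pM// ?yM// (le_trans (ler_normB _ _))// lerD2r qM.
have [eta eta0 etaP] := perturbed_zeros (hC2 m) ddM e0 he.
have /choice[B BP] : forall j, exists B : R, [/\ 0 <= B,
    {in `]0, 1[, forall x, `|h j x| <= B} &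
    {in `]0, 1[, forall x, `|derive1 (h j) x| <= B}].
  move=> j; have [B B0 [hB dhB]] := dirichlet_C2_bounded (hC2 j).
  by exists B; split => // x /subset_itv_oo_cc; exact: hB.
(* [eps k j] is the coefficient of mode j in $T^kS$ divided by that of mode m; it tends to 0 for j <
   m since 0 <= rho j < 1. For m = 0 the denominator is 0 and this normalization is meaningless; $S$
   is then a multiple of $h_0$ and is treated apart. *)
pose rho (j : nat) := (lam j - lam 0%N) / (lam m - lam 0%N).
pose eps k (j : 'I_n) := b 0 j / b 0 m * rho j ^+ k.
have n0 : (0 < n)%N := leq_ltn_trans (leq0n m) (ltn_ord m).
have nR0 : 0 < n%:R :> R by rewrite ltr0n.
(* A share eta / n for each of the fewer than n other modes keeps their total below the tolerance
   [eta], for the functions and for their derivatives. *)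
have small : \forall k \near \oo, forall j : 'I_n, j != m -> `|eps k j| * B j <= eta / n%:R.
  apply: (@filter_forall _ _ (fun j k => j != m -> `|eps k j| * B j <= eta / n%:R) \oo) => j.
  have [jm|jm] := eqVneq j m; first by near=> k.
  have [bj|bj] := eqVneq (b 0 j) 0.
    near=> k => _; rewrite /eps bj !mul0r normr0 mul0r divr_ge0// ltW//.
  have jltm : (j < m)%N by rewrite ltn_neqAle mmax// andbT.
  have rho1 : `|rho j| < 1.
    have l0m : 0 < lam m - lam 0%N.
      by rewrite subr_gt0 lam_lt// (leq_ltn_trans _ jltm).
    have l0j : 0 <= lam j - lam 0%N.
      rewrite subr_ge0; case: (nat_of_ord j) => [//|i]; exact/ltW/lam_lt.
    rewrite /rho ger0_norm; last by rewrite divr_ge0// ltW.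
    by rewrite ltr_pdivrMr// mul1r ltrD2r lam_lt.
  have : (fun k => b 0 j / b 0 m * rho j ^+ k * B j) @ \oo --> 0.
    have E : 0 = b 0 j / b 0 m * 0 * B j by rewrite mulr0 mul0r.
    rewrite [X in _ --> X]E.
    by apply: cvgM; [apply: cvgM; [exact: cvg_cst|exact: cvg_expr]|exact: cvg_cst].
  move=> /cvgr0_norm_le/(_ _ (divr_gt0 eta0 nR0)); apply: filterS => k + _.
  by rewrite normrM (ger0_norm (x:=B j))//; have [] := BP j.
have [k kP] : exists k, forall j : 'I_n, j != m -> `|eps k j| * B j <= eta / n%:R.
  by near \oo => k; exists k; near: k.
pose b' : 'rV[R]_n := \row_j eps k j.
have epsm : (0 < m)%N -> eps k m = 1.
  move=> m0; have l0m : lam m - lam 0%N != 0 by rewrite subr_eq0 gt_eqF// lam_lt.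
  by rewrite /eps /rho !divff// expr1n mulr1.
have [m0|m0] := posnP m.
  apply: zeros_le uc _ => x /c0[x01]; rewrite /lin_comb (bigD1 m)//= big1 ?addr0.
    by move/eqP; rewrite mulf_eq0 (negbTE bm) => /eqP.
  move=> j jm; have [->|/mmax] := eqVneq (b 0 j) 0; first by rewrite mul0r.
  by rewrite m0 leqn0 => /eqP j0'; case/eqP: jm; apply: val_inj; rewrite /= j0'.
have [t [ut st tP]] := lin_comb_liouville_iter k uc c0.
have tP' : zeros_in (lin_comb h b') t.
  move=> x /tP[x01 E]; split => //.
  have -> : lin_comb h b' x = (b 0 m * (lam m - lam 0%N) ^+ k)^-1 *
      lin_comb h (spectral_weight b (fun j => (lam j - lam 0%N) ^+ k)) x.
    rewrite /lin_comb mulr_sumr; apply: eq_bigr => j _.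
    by rewrite !mxE /eps /rho expr_div_n invfM; ring.
  by rewrite E mulr0.
have b'm : b' 0 m = 1 by rewrite mxE epsm.
have near_top (f : nat -> R -> R) x :
    (forall j, `|f j x| <= B j) ->
    `|\sum_(j < n) b' 0 j * f j x - f m x| <= eta.
  move=> fB; rewrite (bigD1 m)//= b'm mul1r addrAC subrr add0r.
  apply: le_trans (ler_norm_sum _ _ _) _.
  apply: (@le_trans _ _ (\sum_(j < n | j != m) eta / n%:R)).
    apply: ler_sum => j jm; rewrite normrM mxE; apply: le_trans (kP j jm).
    by rewrite ler_wpM2l.
  rewrite sumr_const -[X in X <= _]mulr_natr mulrAC ler_pdivrMr// ler_wpM2l ?(ltW eta0)//.
  by rewrite ler_nat (leq_trans (max_card _))// card_ord.
have [u [uu su uP]] := etaP _ _ _ t (lin_comb_C2 b')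
  (fun x x01 => conj (near_top h x (fun j => let: And3 _ H _ := BP j in H x x01))
     (near_top (fun j => derive1 (h j)) x (fun j => let: And3 _ _ H := BP j in H x x01)))
  ut tP'.
by rewrite -st -su; exact: zeros_le.
Unshelve. all: by end_near. Qed.

(** Laplace expansion along the last column, the only one containing x. *)
Lemma slater_row n c x : size c = n ->
  let X := (fun (j : 'I_n.+1) => (rcons c x)`_j) in
  slater h X = lin_comb h (\row_i cofactor (\matrix_(i < n.+1, j < n.+1) h i (X j)) i ord_max) x.
Proof.
move=> sc X; rewrite /slater (expand_det_col _ ord_max) /lin_comb.
by apply: eq_bigr => i _; rewrite !mxE mulrC /X/= nth_rcons sc ltnn eqxx.
Qed.

(** These cofactors delete the column of the last point, so the coefficients of the expansion can be
    computed at a fixed reference point. *)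
Lemma cofactor_last_column n c x y : size c = n ->
  (\row_i cofactor (\matrix_(i < n.+1, j < n.+1) h i ((rcons c x)`_j)) i ord_max) =
  (\row_i cofactor (\matrix_(i < n.+1, j < n.+1) h i ((rcons c y)`_j)) i ord_max).
Proof.
move=> sc; apply/rowP => i; rewrite !mxE; congr (_ * \det _).
apply/matrixP => k l; rewrite !mxE; congr h.
have ll : lift ord_max l = l :> nat by rewrite lift_max.
by rewrite ll !nth_rcons sc ltn_ord.
Qed.

End ChebyshevSystem.

Theorem proposition6p3 (R : realType) (q : R -> R) (lam : nat -> R)
    (h : nat -> R -> R)
    (hq : smooth_near_unit_interval q)
    (hlam : dirichlet_spectrum q lam)
    (hh : forall j : nat, dirichlet_eigenfunction q (lam j) (h j))
    (hbasis : L2_orthonormal_basis h)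
    (n : nat) (hn : (1 <= n)%N) (b : 'rV[R]_n) (hb : b != 0) :
  (zeros_in_unit_interval (lin_comb h b) #<= `I_n.-1)%card /\
  (forall c : seq R,
     size c = n.-1 -> sorted <%R c ->
     zeros_in_unit_interval (lin_comb h b) = [set` c] ->
     (exists C : R, C != 0 /\
        forall x : R, x \in `]0, 1[ ->
          lin_comb h b x = C * slater h (fun j : 'I_n => (rcons c x)`_j)) /\
     (forall z : R, z \in c -> zero_of_order (lin_comb h b) z 1)).
Proof.
have [lam_lt _ _ _] := hlam.
have zeros_lt (a : 'rV[R]_n) (c : seq R) : a != 0 -> uniq c ->
    zeros_in (lin_comb h a) c -> (size c < n)%N.
  exact: (lin_comb_zeros_lt hq lam_lt hh hbasis).
split.
  apply: card_le_uniq => c uc c0; rewrite -ltnS prednK//.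
  by apply: zeros_lt hb uc _ => x /c0.
move=> c sc /lt_sorted_uniq uc cE.
have c0 : zeros_in (lin_comb h b) c.
  by move=> x xc; have : [set` c] x by []; rewrite -cE.
case: n hn b hb zeros_lt sc cE c0 => // n _ b hb zeros_lt /= sc cE c0.
split.
- have [x0 x01 Sx0] : exists2 x, x \in `]0, 1[ & lin_comb h b x != 0.
    apply: contrapT => H.
    (* Vanishing at the n + 1 points 1/2, 1/3, ... of (0, 1) would exceed the zero bound. *)
    pose t : seq R := [seq (i.+2%:R)^-1 | i <- iota 0 n.+1].
    have : (size t < n.+1)%N.
      apply: zeros_lt hb _ _.
        rewrite map_inj_uniq ?iota_uniq// => i j /invr_inj/eqP.
        by rewrite eqr_nat => /eqP[].
      move=> _ /mapP[i _ ->].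
      have i01 : ((i.+2%:R)^-1 : R) \in `]0, 1[.
        by rewrite in_itv/= invr_gt0 ltr0n/= invf_lt1// ?ltr1n// ltr0n.
      by split => //; apply: contrapT => /eqP ix; apply: H; exists (i.+2%:R)^-1.
    by rewrite size_map size_iota ltnn.
  pose X x (j : 'I_n.+1) := (rcons c x)`_j.
  pose M := \matrix_(i < n.+1, j < n.+1) h i (X x0 j).
  have lin_combM (a : 'rV[R]_n.+1) j : (a *m M) 0 j = lin_comb h a (X x0 j).
    by rewrite mxE; apply: eq_bigr => i _; rewrite mxE.
  (* A left kernel vector gives a nonzero combination vanishing at the points of [c] and at [x0],
     which are n + 1 distinct points because $S$ is nonzero at [x0]. *)
  have detM : \det M != 0.
    apply/negP => /det0P[v v0 vM].
    have : (size (rcons c x0) < n.+1)%N; last by rewrite size_rcons sc ltnn.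
    apply: zeros_lt v0 _ _.
      rewrite rcons_uniq uc andbT; apply/negP => /c0[_ /eqP].
      by rewrite (negbTE Sx0).
    move=> x xc; split.
      by move: xc; rewrite mem_rcons inE => /predU1P[->//|/c0[]].
    have ix : (index x (rcons c x0) < n.+1)%N.
      have szr : size (rcons c x0) = n.+1 by rewrite size_rcons sc.
      by rewrite -[X in (_ < X)%N]szr index_mem.
    by have := lin_combM v (Ordinal ix); rewrite vM mxE /X/= nth_index// => <-.
  pose d : 'rV[R]_n.+1 := \row_i cofactor M i ord_max.
  (* $S$ vanishes on [c], so b M is S(x0) times the last unit row; multiplying by the adjugate of M
     gives its last row, which is [d]. *)
  have bd : b = (lin_comb h b x0 / \det M) *: d.
    have bM : b *m M = lin_comb h b x0 *: delta_mx 0 ord_max.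
      apply/rowP => j; rewrite lin_combM !mxE eqxx/= /X nth_rcons sc.
      have [->|jn] := eqVneq j ord_max; first by rewrite /= ltnn eqxx mulr1.
      have jltn : (j < n)%N.
        by rewrite ltn_neqAle -ltnS ltn_ord andbT; apply: contraNneq jn => ?; apply/eqP/val_inj.
      by rewrite jltn mulr0; apply: (c0 _ _).2; rewrite mem_nth ?sc.
    have := congr1 (fun B => B *m \adj M) bM.
    rewrite -mulmxA mul_mx_adj mul_mx_scalar -scalemxAl -rowE => E.
    have -> : d = row ord_max (\adj M) by apply/rowP => i; rewrite !mxE.
    by rewrite mulrC -scalerA -E scalerA mulVf// scale1r.
  exists (lin_comb h b x0 / \det M); split.
    by rewrite mulf_neq0// invr_eq0.
  move=> x x01'; rewrite (slater_row h x sc) (cofactor_last_column h x x0 sc).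
  rewrite -[in LHS]/(lin_comb h b x) {1}bd /lin_comb mulr_sumr.
  by apply: eq_bigr => i _; rewrite !mxE mulrA.
move=> z zc; have [z01 Sz] := c0 z zc.
have [_ Sd _ _ _] := lin_comb_C2 hq hh b.
have dS : derive1n 1 (lin_comb h b) z = lin_comb_deriv h b z.
  by rewrite derive1n1 derive1E (@derive_val _ _ _ _ _ _ _ (Sd z z01)).
split; first by case.
rewrite dS; apply/eqP => dS0.
(* Counting [z] as double yields n + 1 zeros of $TS$, one too many, so all its coefficients vanish.
   Since lam j > lam 0 for j > 0, only the mode 0 of $S$ remains. *)
have [t [ut st tP]] := @lin_comb_liouville _ _ _ _ hq lam_lt hh hbasis _ b c [:: z]
  uc c0 isT ltac:(by move=> x; rewrite inE => /eqP ->) ltac:(by move=> x; rewrite inE => /eqP ->).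
set b' := spectral_weight _ _ in tP.
have b'0 : b' = 0.
  apply/eqP; apply: contraTT isT => b'n0.
  by have := zeros_lt _ _ b'n0 ut tP; rewrite st sc addn1 ltnn.
have bj (j : 'I_n.+1) : j != ord0 -> b 0 j = 0.
  move=> j0; have := congr1 (fun B : 'rV[R]_n.+1 => B 0 j) b'0; rewrite !mxE => /eqP.
  rewrite mulf_eq0 => /orP[/eqP//|]; rewrite subr_eq0 gt_eqF// lam_lt// lt0n.
  by apply: contraNneq j0 => E; apply/eqP/val_inj.
have SE x : lin_comb h b x = b 0 ord0 * h 0%N x.
  by rewrite /lin_comb (bigD1 ord0)//= big1 ?addr0// => j /bj ->; rewrite mul0r.
have b00 : b 0 ord0 != 0.
  apply: contraNneq hb => b00; apply/eqP/rowP => j; rewrite mxE.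
  by have [->|/bj] := eqVneq j ord0.
have hz : zeros_in (h 0%N) [:: z].
  move=> y; rewrite inE => /eqP ->; split => //.
  by move/eqP: Sz; rewrite SE mulf_eq0 (negbTE b00) => /eqP.
by have := eigenfunction_zeros_le hq lam_lt hh hbasis (isT : uniq [:: z]) hz.
Qed.
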